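(* Let $G=(V,E)$ be a finite, simple, connected reflective graph. Then $G$ is a cartesian product (of one or more factors) of graphs from the following list: cocktail party graphs $CP(k)$, Hamming graphs $K_n^m$, Johnson graphs $J(n,k)$, halved cubes, the Schläfli graph, the Gosset graph.
   Context: $d$ is the combinatorial distance. For adjacent $x\sim y$ let $V_x^y=\{v: d(v,x)<d(v,y)\}$, $V^{xy}=\{v:d(v,x)=d(v,y)\}$. A reflection from $x$ to $y$ is a graph automorphism $\phi$ with $\phi\circ\phi=\mathrm{id}$, $\phi(x)=y$, such that the edges between $V_x^y$ and $V_y^x$ are exactly $\{\{x',\phi(x')\}:x'\in V_x^y\}$ and $\phi$ fixes $V^{xy}$ pointwise. $G$ is reflective if every edge admits a reflection. $CP(k)$: $K_{2k}$ minus a perfect matching. Hamming graph $K_n^m$: cartesian product of $m$ copies of the complete graph $K_n$. $J(n,k)$: $k$-subsets of an $n$-set, adjacent iff sharing $k-1$ elements. Halved cube: even-weight binary strings of length $n$, adjacent iff differing in exactly two coordinates. Schläfli graph: srg$(27,16,10,8)$. Gosset graph: the 56-vertex 27-regular distance regular graph (1-skeleton of the $3_{21}$ polytope). Cartesian product: $(a,b)\sim(a',b')$ iff ($a=a'$, $b\sim b'$) or ($a\sim a'$, $b=b'$). *)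

(* Defs.v *)
From mathcomp Require Import all_boot.
Set Implicit Arguments. Unset Strict Implicit. Unset Printing Implicit Defensive.

Record sgraph := SGraph { vtx : finType; adj : rel vtx }.

Definition simple_graph (G : sgraph) :=
  symmetric (@adj G) /\ irreflexive (@adj G).

Definition connected_graph (G : sgraph) :=
  forall x y : vtx G, connect (@adj G) x y.

(** Combinatorial distance: the length of a shortest walk from x to y
    (meaningful for connected graphs, where it is < #|V|). *)
Definition walk_of_length (G : sgraph) (x y : vtx G) (n : nat) : bool :=
  [exists p : n.-tuple (vtx G), path (@adj G) x p && (last x p == y)].

Definition dist (G : sgraph) (x y : vtx G) : nat :=
  find (walk_of_length x y) (iota 0 #|vtx G|).

Definition Vside (G : sgraph) (x y : vtx G) : {set vtx G} :=
  [set v | dist v x < dist v y].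
Definition Vmid (G : sgraph) (x y : vtx G) : {set vtx G} :=
  [set v | dist v x == dist v y].

Definition automorphism (G : sgraph) (phi : vtx G -> vtx G) :=
  bijective phi /\ forall u v, @adj G (phi u) (phi v) = @adj G u v.

Definition reflection (G : sgraph) (x y : vtx G) (phi : vtx G -> vtx G) :=
  [/\ automorphism phi,
      (forall v, phi (phi v) = v),
      phi x = y,
      ((forall u, u \in Vside x y -> phi u \in Vside y x /\ @adj G u (phi u)) /\
       (forall u v, u \in Vside x y -> v \in Vside y x -> @adj G u v -> v = phi u))
    & (forall v, v \in Vmid x y -> phi v = v)].

Definition reflective (G : sgraph) :=
  forall x y : vtx G, @adj G x y -> exists phi, reflection x y phi.

Definition isomorphic (G H : sgraph) :=
  exists f : vtx G -> vtx H,
    bijective f /\ forall u v, @adj H (f u) (f v) = @adj G u v.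

Definition cart (G H : sgraph) : sgraph :=
  @SGraph (vtx G * vtx H)%type
    (fun p q => ((p.1 == q.1) && @adj H p.2 q.2) || (@adj G p.1 q.1 && (p.2 == q.2))).

Fixpoint cart_list (g : sgraph) (l : seq sgraph) : sgraph :=
  if l is h :: l' then cart g (cart_list h l') else g.

Definition Kgraph (n : nat) : sgraph := @SGraph 'I_n (fun i j => i != j).

(** Cocktail party graph CP(k): K_{2k} minus the perfect matching
    {(i,false),(i,true)}. *)
Definition CP (k : nat) : sgraph :=
  @SGraph ('I_k * bool)%type (fun p q => p.1 != q.1).

Fixpoint Hamming (n m : nat) : sgraph :=
  if m is m'.+1 then cart (Kgraph n) (Hamming n m') else Kgraph 1.

Definition Johnson (n k : nat) : sgraph :=
  @SGraph {A : {set 'I_n} | #|A| == k}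
    (fun A B => (val A != val B) && (#|val A :&: val B| == k.-1)).

Definition halved_cube (n : nat) : sgraph :=
  @SGraph {f : {ffun 'I_n -> bool} | ~~ odd #|[set i | f i]|}
    (fun f g => #|[set i | val f i != val g i]| == 2).

(** Gosset graph: vertices (A, s) with A a 2-subset of an 8-set and s a sign;
    (A,s) ~ (B,s) iff |A ∩ B| = 1, and (A,s) ~ (B,~s) iff A ∩ B = ∅.
    (Equivalently: the 56 vectors ±(3,3,-1,...,-1) up to permutation,
    adjacent iff their inner product is 8.) *)
Definition gosset_rel (a b : {set 'I_8} * bool) : bool :=
  ((a.2 == b.2) && (#|a.1 :&: b.1| == 1)) ||
  ((a.2 != b.2) && [disjoint a.1 & b.1]).

Definition gosset_vtx : finType := ({A : {set 'I_8} | #|A| == 2} * bool)%type.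

Definition Gosset : sgraph :=
  @SGraph gosset_vtx (fun a b => gosset_rel (val a.1, a.2) (val b.1, b.2)).

(** Schläfli graph srg(27,16,10,8): the subgraph of the Gosset graph induced
    on the neighbourhood of the vertex ({0,1}, true). *)
Definition base01 : {set 'I_8} := [set inord 0; inord 1].

Definition Schlaefli : sgraph :=
  @SGraph {a : gosset_vtx | gosset_rel (base01, true) (val a.1, a.2)}
    (fun a b => @adj Gosset (val a) (val b)).

Inductive factor :=
| FCP of nat
| FHamming of nat & nat
| FJohnson of nat & nat
| FHalvedCube of nat
| FSchlaefli
| FGosset.

Definition factor_graph (f : factor) : sgraph :=
  match f with
  | FCP k => CP k
  | FHamming n m => Hamming n m
  | FJohnson n k => Johnson n k
  | FHalvedCube n => halved_cube n
  | FSchlaefli => Schlaefli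
  | FGosset => Gosset
  end.

(* Main.v *)
Require Import Defs.
From mathcomp Require Import all_boot.
From mathcomp Require Import all_order all_fingroup all_algebra zify ring.
Set Implicit Arguments. Unset Strict Implicit. Unset Printing Implicit Defensive.
Import GRing.Theory.

(** Idea. For an edge xy put eps(u) = d(u,x) - d(u,y), which lies in {-1,0,1}.
    The reflection phi from x to y satisfies
      d(u, phi v) = d(u, v) + eps(u) eps(v),
    as if the graph sat in a Euclidean space with squared distances 2d and phi
    were an orthogonal reflection. Hence, once a base point x is fixed, a vertex
    u is determined by its values eps(u) over the edges at x, and the reflections
    of these edges act on these vectors in a way that depends only on the graph
    induced on the neighbours N(x). Consequently two reflective graphs with
    isomorphic neighbourhood graphs are isomorphic.

    Every connected component C of N(x) is again reflective, of diameter at most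
    2. By induction the neighbourhood of a vertex of C is a disjoint union of
    neighbourhoods of factors from the list, so C is a product of such factors;
    because of its diameter, C is K_a x K_b, CP(k), J(n,2), the halved 5-cube or
    the Schlaefli graph. These are the neighbourhoods in J(a+b,a), CP(k+1), the
    halved n-cube, the Schlaefli graph and the Gosset graph. So N(x) is the
    neighbourhood of a vertex in a product of listed graphs, and G is that
    product. *)

(** * Distances and reflections *)

Section Distance.
Variable G : sgraph.
Hypotheses (simpleG : simple_graph G) (connG : connected_graph G).
Notation d := (@dist G).

Let adjC : symmetric (@adj G) := simpleG.1.
Let adjxx : irreflexive (@adj G) := simpleG.2.

Lemma walkP (x y : vtx G) n :
  reflect (exists p, [/\ size p = n, path (@adj G) x p & last x p = y])
          (walk_of_length x y n).
Proof.
apply: (iffP existsP) => [[p /andP[hp /eqP hl]]|[p [hs hp hl]]].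
  by exists p; rewrite size_tuple.
by exists (tcast hs (in_tuple p)); rewrite val_tcast /= hp hl eqxx.
Qed.

Lemma dist_path_le (x : vtx G) p : path (@adj G) x p -> d x (last x p) <= size p.
Proof.
move=> hp; have wp : walk_of_length x (last x p) (size p) by apply/walkP; exists p.
rewrite leqNgt; apply/negP => lt.
have szp : size p < #|vtx G|.
  by apply: leq_trans lt _; rewrite -[leqRHS](size_iota 0); apply: find_size.
by have := before_find 0 lt; rewrite nth_iota // add0n wp.
Qed.

Lemma dist_path (x y : vtx G) :
  exists p, [/\ size p = d x y, path (@adj G) x p & last x p = y].
Proof.
apply/walkP; have [p hp ->] := connectP (connG x y).
(* A walk without repeated vertices is shorter than [#|vtx G|], so the search in [dist] succeeds. *)
case/shortenP: hp => q hq uq _.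
have szq : size q < #|vtx G|.
  by rewrite -[_.+1]/(size (x :: q)) -(card_uniqP uq) max_card.
have h : has (walk_of_length x (last x q)) (iota 0 #|vtx G|).
  by apply/hasP; exists (size q); rewrite ?mem_iota //; apply/walkP; exists q.
have := nth_find 0 h; rewrite -/(d x (last x q)) nth_iota ?add0n //.
by move: h; rewrite has_find size_iota.
Qed.

Lemma dist_triangle (y x z : vtx G) : d x z <= d x y + d y z.
Proof.
have [p [<- hp lp]] := dist_path x y; have [q [<- hq lq]] := dist_path y z.
have <- : last x (p ++ q) = z by rewrite last_cat lp.
by rewrite -size_cat dist_path_le // cat_path hp lp.
Qed.

Lemma dist_symmetric (x y : vtx G) : d x y = d y x.
Proof.
suff le u v : d u v <= d v u by apply/eqP; rewrite eqn_leq !le.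
have [p [<- hp <-]] := dist_path v u.
have lv : last (last v p) (rev (belast v p)) = v.
  by case: p hp => //= w p _; rewrite rev_cons last_rcons.
rewrite -[X in d _ X]lv -[leqRHS](size_belast v) -(size_rev (belast v p)).
apply: dist_path_le; rewrite rev_path.
by rewrite (eq_path (e' := @adj G)) // => a b; apply: adjC.
Qed.

Lemma dist_eq0 (x y : vtx G) : (d x y == 0) = (x == y).
Proof.
apply/eqP/eqP => [h|->].
  by have [p [sp _ <-]] := dist_path x y; case: p sp => //=; rewrite h.
by apply/eqP; rewrite -leqn0; apply: (@dist_path_le y [::]).
Qed.

Lemma dist_eq1 (x y : vtx G) : adj x y = (d x y == 1).
Proof.
apply/idP/eqP => [h|h].
  have le1 : d x y <= 1 by apply: (@dist_path_le x [:: y]); rewrite /= h.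
  have : d x y != 0 by rewrite dist_eq0; apply: contraTneq h => ->; rewrite adjxx.
  by case: (d x y) le1 => [|[|]].
have [p [sp hp <-]] := dist_path x y.
by move: sp hp; rewrite h; case: p => [//|z [|//]] _ /=; rewrite andbT.
Qed.

Lemma dist_adj (x y u : vtx G) : adj x y -> d u x <= (d u y).+1.
Proof.
rewrite dist_eq1 => /eqP h.
by have := dist_triangle y u x; rewrite (dist_symmetric y x) h addn1.
Qed.

Lemma dist_descent (x u : vtx G) : u != x -> exists2 y, adj x y & d u y < d u x.
Proof.
have [p [sp hp hl]] := dist_path x u; subst u.
case: p sp hp => [|y p] /=; first by rewrite eqxx.
rewrite (dist_symmetric _ x) => <- /andP[hxy hp] _; exists y => //.
by rewrite dist_symmetric ltnS dist_path_le.
Qed.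

(** Besides automorphisms this covers folding maps, which collapse some edges to points. *)
Lemma dist_contraction (F : vtx G -> vtx G) :
  (forall a b, adj a b -> F a = F b \/ adj (F a) (F b)) ->
  forall u v, d (F u) (F v) <= d u v.
Proof.
move=> hF u v; have [p [<- hp <-]] := dist_path u v.
elim: p u hp => [|w p IH] u /=; first by rewrite leqn0 dist_eq0.
case/andP=> /hF [-> /IH /leqW //|hw /IH].
move=> le; apply: leq_trans (dist_triangle (F w) _ _) _.
by move: hw; rewrite dist_eq1 => /eqP ->; rewrite add1n.
Qed.

Section Reflection.
Variables (x y : vtx G) (phi : vtx G -> vtx G).
Hypothesis hphi : reflection x y phi.

Lemma reflection_dist u v : d (phi u) (phi v) = d u v.
Proof.
case: hphi => -[_ hadj] hinv _ _ _.
have le a b : d (phi a) (phi b) <= d a b.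
  by apply: dist_contraction => {}a {}b ab; right; rewrite hadj.
by apply/eqP; rewrite eqn_leq le -{1}(hinv u) -{1}(hinv v) le.
Qed.

Lemma reflection_dist_swap u v : d u (phi v) = d (phi u) v.
Proof. by case: hphi => _ hinv _ _ _; rewrite -{1}(hinv u) reflection_dist. Qed.

Lemma reflection_swap : phi x = y /\ phi y = x.
Proof. by case: hphi => _ hinv <- _ _; rewrite hinv. Qed.

Lemma reflection_side u : (phi u \in Vside x y) = (u \in Vside y x).
Proof.
have [px py] := reflection_swap.
by rewrite !inE -!reflection_dist_swap px py.
Qed.

(** Applying [phi] on the [y] side and the identity elsewhere is a contraction: edges between the
    two sides collapse, and an edge from the middle to the [y] side stays an edge because [phi]
    fixes the middle. *)
Lemma reflection_fold u a :
  a \in Vside x y -> u \notin Vside x y -> d u (phi a) <= d u a.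
Proof.
case: hphi => -[_ hadj] hinv hxy [hside hedge] hmid.
pose F w := if w \in Vside y x then phi w else w.
have FP a1 b1 : adj a1 b1 -> a1 \notin Vside y x -> b1 \in Vside y x ->
    a1 = phi b1 \/ adj a1 (phi b1).
  move=> ab na bB; have [aA|naA] := boolP (a1 \in Vside x y).
    by left; rewrite (hedge _ _ aA bB ab) hinv.
  right; rewrite -(hmid a1) ?hadj //.
  by move: na naA; rewrite !inE -!leqNgt => h1 h2; rewrite eqn_leq h1 h2.
have hF a1 b1 : adj a1 b1 -> F a1 = F b1 \/ adj (F a1) (F b1).
  rewrite /F => ab.
  case: (boolP (a1 \in Vside y x)) => ha; case: (boolP (b1 \in Vside y x)) => hb.
  - by right; rewrite hadj.
  - by rewrite adjC in ab; have [->|h] := FP _ _ ab hb ha;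
      [left|right; rewrite adjC].
  - exact: FP.
  - by right.
move=> aA uA; have Fa : F a = a.
  by rewrite /F ifN //; move: aA; rewrite !inE -leqNgt => /ltnW.
case: (boolP (u \in Vside y x)) => hu.
  have Fu : F u = phi u by rewrite /F hu.
  by rewrite reflection_dist_swap -Fu -{1}Fa; apply: dist_contraction.
rewrite reflection_dist_swap hmid //.
by move: hu uA; rewrite !inE -!leqNgt => h1 h2; rewrite eqn_leq h1 h2.
Qed.

End Reflection.

Hypothesis reflG : reflective G.

(* The reflection of the edge v -- phi v has the same half-spaces as phi. *)
Lemma reflection_side_strict x y phi u v :
  adj x y -> reflection x y phi -> u \in Vside x y -> v \in Vside x y ->
  d u v < d u (phi v).
Proof.
move=> hxy hphi uA vA.
have [px py] := reflection_swap hphi.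
case: (hphi) => _ _ _ [hside _] _.
have [_ hv] := hside _ vA.
have [psi hpsi] := reflG hv.
have dxv : d x v < d x (phi v).
  by rewrite (reflection_dist_swap hphi) px !(dist_symmetric _ v); move: vA; rewrite inE.
have dyv : d y (phi v) < d y v.
  by rewrite (reflection_dist_swap hphi) py !(dist_symmetric _ v); move: vA; rewrite inE.
case: (hpsi) => _ _ _ [_ hedge] _.
(* The edge from [x] to [y] also crosses between the sides of [v] and [phi v], and [psi] pairs the
   ends of all such edges. *)
have yx : y = psi x by apply: hedge; rewrite ?inE.
(* If [u] were not nearer to [v], folding by [psi] would give [d u y <= d u x]. *)
rewrite ltnNge; apply/negP => le.
have xs : x \in Vside v (phi v) by rewrite inE.
have us : u \notin Vside v (phi v) by rewrite inE -leqNgt.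
have := reflection_fold hpsi xs us; rewrite -yx.
by move: uA; rewrite inE ltnNge => /negP.
Qed.

End Distance.

Local Open Scope ring_scope.
(** The eps of the idea above, for any function [D], since the factors come with explicit distance
    formulas. *)
Definition halfsign (T : Type) (D : T -> T -> nat) (x y u : T) : int :=
  (D u x)%:Z - (D u y)%:Z.

(** [w] is the mirror image of [v] in the edge from [x] to [y], described by distances alone. In
    this form reflections restrict to components of a neighbourhood and extend to products. *)
Definition refl_at (T : Type) (D : T -> T -> nat) (x y v w : T) :=
  forall u, (D u w)%:Z = (D u v)%:Z + halfsign D x y u * halfsign D x y v.
Local Close Scope ring_scope.

(** If [u] and [v] lie on the [x] side, the distance grows by exactly one: strictness bounds it
    below, the edge from [v] to [phi v] above. The other cases follow by applying [phi] to one or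
    both points, or because [phi] fixes the middle. *)
Lemma reflection_refl_at (G : sgraph) (x y : vtx G) phi v :
  simple_graph G -> connected_graph G -> reflective G ->
  adj x y -> reflection x y phi -> refl_at (@dist G) x y v (phi v).
Proof.
move=> sG cG rG xy hphi u; rewrite /halfsign.
have symd := dist_symmetric sG cG.
have same a b : a \in Vside x y -> b \in Vside x y ->
    dist a (phi b) = (dist a b).+1.
  move=> aA bA; have := reflection_side_strict sG cG rG xy hphi aA bA.
  case: (hphi) => _ _ _ [/(_ _ bA) [_ hb] _] _.
  rewrite (sG.1) in hb; have := dist_adj sG cG a hb; lia.
have eqd := reflection_dist sG cG hphi.
have sw := reflection_dist_swap sG cG hphi.
case: (hphi) => _ hinv _ _ hmid.
have sd a : [\/ [/\ a \in Vside x y & (dist a y = (dist a x).+1)%N],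
                [/\ phi a \in Vside x y & (dist a x = (dist a y).+1)%N] |
                 phi a = a /\ dist a x = dist a y].
  have yx : adj y x by rewrite sG.1.
  have h1 := dist_adj sG cG a xy; have h2 := dist_adj sG cG a yx.
  rewrite (reflection_side sG cG hphi) !inE.
  have [h|h|h] := ltngtP (dist a x) (dist a y).
  - by constructor 1; split => //; lia.
  - by constructor 2; split => //; lia.
  - by constructor 3; split => //; apply: hmid; rewrite inE h.
case: (sd u) => [[uA eu]|[uA eu]|[uM eu]].
- case: (sd v) => [[vA ev]|[vA ev]|[vM ev]].
  + rewrite same // eu ev; lia.
  + have := same _ _ uA vA; rewrite hinv eu ev => ->; lia.
  + rewrite vM ev; lia.
- case: (sd v) => [[vA ev]|[vA ev]|[vM ev]].
  + have := same _ _ uA vA; rewrite eqd -sw eu ev => ->; lia.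
  + have := same _ _ uA vA; rewrite !eqd eu ev => ->; lia.
  + rewrite vM ev; lia.
- rewrite sw uM eu; lia.
Qed.

(** * Matching vertices through a base point *)

(** A reflective graph as seen from one vertex: only edges at [x] are reflected. Each factor can
    thus be checked at a single convenient base point. *)
Record rmodel (G : sgraph) (D : vtx G -> vtx G -> nat) (x : vtx G) : Prop :=
  RModel {
    rm_eq0 : forall u v, (D u v == 0) = (u == v);
    rm_sym : forall u v, D u v = D v u;
    rm_adj : forall u v, adj u v = (D u v == 1);
    rm_nbr2 : forall y z, adj x y -> adj x z -> D y z <= 2;
    rm_desc : forall u, u != x -> exists2 y, adj x y & D u y < D u x;
    rm_refl : forall y v, adj x y -> exists w, refl_at D x y v w }.

Definition rmetric (G : sgraph) (D : vtx G -> vtx G -> nat) : Prop :=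
  forall x, rmodel D x.

Lemma reflective_rmetric (G : sgraph) :
  simple_graph G -> connected_graph G -> reflective G -> rmetric (@dist G).
Proof.
move=> sG cG rG x; split.
- exact: dist_eq0.
- exact: dist_symmetric.
- exact: dist_eq1.
- move=> y z; rewrite !dist_eq1 // => /eqP xy /eqP xz.
  by have := dist_triangle cG x y z; rewrite (dist_symmetric sG cG y x) xy xz.
- exact: dist_descent.
- move=> y v xy; have [phi hphi] := rG _ _ xy.
  by exists (phi v); apply: reflection_refl_at.
Qed.

Section Reflection.
Variables (G : sgraph) (D : vtx G -> vtx G -> nat) (x : vtx G).
Hypothesis mG : rmodel D x.
Local Open Scope ring_scope.

Lemma rm_dist0 u : D u u = 0%N.
Proof. by apply/eqP; rewrite (rm_eq0 mG). Qed.

Lemma halfsign_edge y : adj x y -> halfsign D x y x = -1 /\ halfsign D x y y = 1.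
Proof.
rewrite /halfsign (rm_adj mG) !rm_dist0 (rm_sym mG y) => /eqP ->; lia.
Qed.

Lemma halfsign_refl y v w : adj x y -> refl_at D x y v w ->
  halfsign D x y w = - halfsign D x y v.
Proof.
move=> xy h; have [ex ey] := halfsign_edge xy.
rewrite {1}/halfsign !(rm_sym mG w) (h x) (h y) ex ey.
by rewrite !(rm_sym mG _ v) /halfsign; lia.
Qed.

Lemma refl_at_dist y v w v' w' : adj x y ->
  refl_at D x y v w -> refl_at D x y v' w' -> D w w' = D v v'.
Proof.
move=> xy h h'; have := h' w; rewrite (halfsign_refl xy h) (rm_sym mG w v') (h v').
rewrite (rm_sym mG v'); lia.
Qed.

Lemma refl_at_sym y v w : adj x y -> refl_at D x y v w -> refl_at D x y w v.
Proof. move=> xy h u; have := h u; rewrite (halfsign_refl xy h); lia. Qed.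

Lemma refl_at_base y v w : adj x y -> refl_at D x y v w -> D w x = D v y.
Proof.
move=> xy h; have [ex ey] := halfsign_edge xy.
have := h x; rewrite ex /halfsign !(rm_sym mG x); lia.
Qed.

(** With squared distances [2 D], the number [2 - D z y] is the inner product of [y - x] and
    [z - x]. Only distances between neighbours of [x] enter, so the rule transfers between graphs
    with isomorphic neighbourhoods. *)
Lemma halfsign_refl_other y z v w : adj x y -> adj x z -> refl_at D x y v w ->
  halfsign D x z w = halfsign D x z v + ((D z y)%:Z - 2) * halfsign D x y v.
Proof.
move=> xy xz h; have [ex ey] := halfsign_edge xy.
have ez : halfsign D x y z = 1 - (D z y)%:Z.
  by move: xz; rewrite /halfsign (rm_adj mG) (rm_sym mG) => /eqP ->.
rewrite {1}/halfsign !(rm_sym mG w) (h x) (h z) ex ez.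
rewrite {3}/halfsign !(rm_sym mG _ v); lia.
Qed.

Lemma halfsign_base u : (forall y, adj x y -> halfsign D x y u = -1) -> u = x.
Proof.
move=> h; apply/eqP/negPn/negP => /(rm_desc mG)[y /h].
rewrite /halfsign; lia.
Qed.

End Reflection.

Section Matching.
Variables (I : Type) (G H : sgraph).
Variables (D : vtx G -> vtx G -> nat) (D' : vtx H -> vtx H -> nat).
Variables (x : vtx G) (x' : vtx H).
Hypotheses (mG : rmodel D x) (mH : rmodel D' x').
Variables (al : I -> vtx G) (al' : I -> vtx H).
Hypotheses (alN : forall i, adj x (al i)) (alN' : forall i, adj x' (al' i)).
Hypothesis (al_onto : forall y, adj x y -> exists i, y = al i).
Hypothesis (al_onto' : forall y, adj x' y -> exists i, y = al' i).
Hypothesis al_dist : forall i j, D (al i) (al j) = D' (al' i) (al' j).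

(** Equality of coordinates, the two neighbourhoods being identified through the common index type
    [I]. *)
Definition matched (u : vtx G) (u' : vtx H) :=
  forall i, halfsign D x (al i) u = halfsign D' x' (al' i) u'.

Lemma matched_refl i v w v' w' : matched v v' ->
  refl_at D x (al i) v w -> refl_at D' x' (al' i) v' w' -> matched w w'.
Proof.
move=> h r r' j.
by rewrite (halfsign_refl_other mG _ _ r) // (halfsign_refl_other mH _ _ r') //
           al_dist !h.
Qed.

Lemma matched_base : matched x x'.
Proof.
move=> i; have [-> _] := halfsign_edge mG (alN i).
by have [-> _] := halfsign_edge mH (alN' i).
Qed.

Lemma matched_base_eq u' : matched x u' -> u' = x'.
Proof.
move=> h; apply: (halfsign_base mH) => _ /al_onto' [i ->].
by rewrite -h; have [-> _] := halfsign_edge mG (alN i).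
Qed.

(** Reflecting [u] in an edge from [x] to a neighbour nearer to [u] gives a vertex nearer to [x].
    Its partner, reflected in the corresponding edge, is a partner of [u]. *)
Lemma matched_total u : exists u', matched u u'.
Proof.
have [n] := ubnP (D u x); elim: n u => // n IH u.
rewrite ltnS => lt; case: (eqVneq u x) => [->|/(rm_desc mG)[_ /al_onto[i ->] ui]].
  by exists x'; apply: matched_base.
have [w r] := rm_refl mG u (alN i).
have [|w' hw] := IH w; first by rewrite (refl_at_base mG _ r) // (leq_trans ui).
have [u' r'] := rm_refl mH w' (alN' i).
by exists u'; apply: matched_refl hw (refl_at_sym mG _ r) r'.
Qed.

(** Half-signs give only differences of distances. The reflected pair supplies the missing value:
    the image of [u] is as far from [x] as [u] is from the neighbour used. *)
Lemma matched_dist_base u u' : matched u u' -> D u x = D' u' x'.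
Proof.
have [n] := ubnP (D u x); elim: n u u' => // n IH u u'.
rewrite ltnS => lt; case: (eqVneq u x) => [->|/(rm_desc mG)[_ /al_onto[i ->] ui]].
  by move/matched_base_eq=> ->; rewrite (rm_dist0 mG) (rm_dist0 mH).
move=> h; have [w r] := rm_refl mG u (alN i).
have [w' r'] := rm_refl mH u' (alN' i).
have := IH w w'; rewrite (refl_at_base mG _ r) // (refl_at_base mH _ r') //.
move=> /(_ (leq_trans ui lt) (matched_refl h r r')).
have := h i; rewrite /halfsign; lia.
Qed.

(** Reflecting all four vertices in corresponding edges keeps both distances and brings [u] nearer
    to [x], until [matched_dist_base] applies. *)
Lemma matched_dist u u' v v' : matched u u' -> matched v v' -> D u v = D' u' v'.
Proof.
have [n] := ubnP (D u x); elim: n u u' v v' => // n IH u u' v v'.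
rewrite ltnS => lt; case: (eqVneq u x) => [->|/(rm_desc mG)[_ /al_onto[i ->] ui]].
  move/matched_base_eq=> -> hv.
  by rewrite (rm_sym mG) (rm_sym mH); apply: matched_dist_base.
move=> hu hv; have [wu ru] := rm_refl mG u (alN i).
have [wu' ru'] := rm_refl mH u' (alN' i).
have [wv rv] := rm_refl mG v (alN i).
have [wv' rv'] := rm_refl mH v' (alN' i).
rewrite -(refl_at_dist mG (alN i) ru rv) -(refl_at_dist mH (alN' i) ru' rv').
apply: IH.
- by rewrite (refl_at_base mG _ ru) // (leq_trans ui).
- exact: matched_refl hu ru ru'.
- exact: matched_refl hv rv rv'.
Qed.

End Matching.

Definition isometric (G H : sgraph) (D : vtx G -> vtx G -> nat)
    (D' : vtx H -> vtx H -> nat) : Prop :=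
  exists f : vtx G -> vtx H, bijective f /\ forall u v, D' (f u) (f v) = D u v.

(** Matching is total in both directions and preserves distances. As distance zero means equality,
    choice functions for the two directions are mutually inverse. *)
Lemma rmodel_isometric (I : Type) (G H : sgraph) D D' (x : vtx G) (x' : vtx H)
    (al : I -> vtx G) (al' : I -> vtx H) :
  rmodel D x -> rmodel D' x' ->
  (forall i, adj x (al i)) -> (forall i, adj x' (al' i)) ->
  (forall y, adj x y -> exists i, y = al i) ->
  (forall y, adj x' y -> exists i, y = al' i) ->
  (forall i j, D (al i) (al j) = D' (al' i) (al' j)) ->
  isometric D D'.
Proof.
move=> mG mH alN alN' on on' ald.
pose R := matched D D' x x' al al'.
have RV u u' : R u u' <-> matched D' D x' x al' al u' u.
  by split=> h i; rewrite h.
have tot := matched_total mG mH alN alN' on ald.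
have tot' := matched_total mH mG alN' alN on' (fun i j => esym (ald i j)).
have Rd := matched_dist mG mH alN alN' on on' ald.
have [f hf] := fin_all_exists tot; have [g hg] := fin_all_exists tot'.
have hgR u' : R (g u') u' by apply/RV; apply: hg.
exists f; split; last by move=> u v; rewrite -(Rd _ _ _ _ (hf u) (hf v)).
exists g => u; apply/eqP.
  by rewrite -(rm_eq0 mG) (Rd _ _ _ _ (hgR (f u)) (hf u)) (rm_dist0 mH).
by rewrite -(rm_eq0 mH) -(Rd _ _ _ _ (hf (g u)) (hgR u)) (rm_dist0 mG).
Qed.

(** * Neighbourhoods *)

Definition induced (G : sgraph) (A : {set vtx G}) : sgraph :=
  @SGraph {a | a \in A} (fun a b => adj (val a) (val b)).

Definition nbr_iso (C H : sgraph) (x : vtx H) (al : vtx C -> vtx H) : Prop :=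
  [/\ injective al, forall y, adj x y <-> exists c, y = al c
    & forall a b, adj (al a) (al b) = adj a b].

Definition cart_dist (G H : sgraph) (D : vtx G -> vtx G -> nat)
    (D' : vtx H -> vtx H -> nat) (p q : vtx (cart G H)) : nat :=
  D p.1 q.1 + D' p.2 q.2.

Section RModelBasics.
Variables (G : sgraph) (D : vtx G -> vtx G -> nat) (x : vtx G).
Hypothesis mG : rmodel D x.

Lemma rm_adjC (u v : vtx G) : adj u v = adj v u.
Proof. by rewrite !(rm_adj mG) (rm_sym mG). Qed.

Lemma rm_adjxx (u : vtx G) : adj u u = false.
Proof. by rewrite (rm_adj mG) (rm_dist0 mG). Qed.

Lemma rm_adj_neq (u v : vtx G) : adj u v -> u != v.
Proof. by apply: contraTneq => ->; rewrite rm_adjxx. Qed.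

Lemma rm_edge1 y : adj x y -> D x y = 1 /\ D y x = 1.
Proof. by rewrite (rm_sym mG y) (rm_adj mG) => /eqP. Qed.

Lemma rm_nbr_dist y z : adj x y -> adj x z ->
  D y z = if y == z then 0 else if adj y z then 1 else 2.
Proof.
move=> xy xz; have := rm_nbr2 mG xy xz; rewrite -(rm_eq0 mG) (rm_adj mG).
by case: (D y z) => [|[|[|]]].
Qed.

End RModelBasics.

(** An edge at the base point changes one coordinate, so its reflection acts on that coordinate
    alone. *)
Lemma rmodel_cart (G H : sgraph) D D' (x : vtx G) (x' : vtx H) :
  rmodel D x -> rmodel D' x' ->
  @rmodel (cart G H) (cart_dist D D') (x, x').
Proof.
move=> mG mH.
have adjE u v : @adj (cart G H) u v = (cart_dist D D' u v == 1).
  rewrite /= /cart_dist -(rm_eq0 mG) -(rm_eq0 mH) (rm_adj mG) (rm_adj mH); lia.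
split=> //.
- by move=> [a b] [c d]; rewrite /cart_dist addn_eq0 (rm_eq0 mG) (rm_eq0 mH).
- by move=> [a b] [c d]; rewrite /cart_dist (rm_sym mG) (rm_sym mH).
- move=> [a b] [c d]; rewrite /cart_dist /=.
  case/orP=> /andP[] => [/eqP<- h1|h1 /eqP<-] /orP[] /andP[]
    => [/eqP<- h2|h2 /eqP<-|/eqP<- h2|h2 /eqP<-].
  + by rewrite (rm_dist0 mG) (rm_nbr2 mH).
  + by rewrite (rm_edge1 mG h2).1 (rm_edge1 mH h1).2.
  + by rewrite (rm_edge1 mG h1).2 (rm_edge1 mH h2).1.
  + by rewrite (rm_dist0 mH) addn0 (rm_nbr2 mG).
- move=> [a b]; rewrite xpair_eqE negb_and => /orP[/(rm_desc mG)|/(rm_desc mH)].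
    by case=> y h1 h2; exists (y, x'); rewrite /= ?h1 ?eqxx ?orbT // /cart_dist ltn_add2r.
  by case=> y h1 h2; exists (x, y); rewrite /= ?h1 ?eqxx ?orbT // /cart_dist ltn_add2l.
- move=> [a b] [c d] /= /orP[]/andP[] => [/eqP <- xb|xa /eqP<-].
    have [w hw] := rm_refl mH d xb; exists (c, w) => -[e f].
    by have := hw f; rewrite /halfsign /cart_dist /=; lia.
  have [w hw] := rm_refl mG c xa; exists (w, d) => -[e f].
  by have := hw e; rewrite /halfsign /cart_dist /=; lia.
Qed.

(** * Components of a neighbourhood *)

Definition nbr_rel (G : sgraph) (x : vtx G) : rel (vtx G) :=
  [rel a b | [&& adj x a, adj x b & adj a b]].

Section Component.
Variables (G : sgraph) (D : vtx G -> vtx G -> nat) (x : vtx G).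
Hypothesis mG : rmetric D.
Let mx := mG x.
Let e := nbr_rel x.

Lemma nbr_rel_sym : symmetric e.
Proof. by move=> a b; rewrite /e /nbr_rel /= (rm_adjC mx a b) andbCA. Qed.

Lemma nbr_connectC : connect_sym e.
Proof. exact/sym_connect_sym/nbr_rel_sym. Qed.

Lemma nbr_closed : closed e [set z | adj x z].
Proof. by move=> a b /and3P[xa xb _]; rewrite !inE xa xb. Qed.

(* The witness is the image of a under the reflection of the edge bc. *)
Lemma nbr_path4 a b c d : adj x a -> adj x b -> adj x c -> adj x d ->
  adj a b -> adj b c -> adj c d -> D a c = 2 -> D b d = 2 -> D a d = 2 ->
  exists z, [/\ adj x z, adj a z & adj z d].
Proof.
move=> xa xb xc xd ab bc cd ac bd ad.
have [w hw] := rm_refl (mG b) a bc; exists w.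
move: xa xb xc xd ab bc cd; rewrite !(rm_adj mx).
move=> /eqP xa /eqP xb /eqP xc /eqP xd /eqP ab /eqP bc /eqP cd.
rewrite (rm_sym mx w).
(* Relative to the edge from [b] to [c], the half-signs of [x], [a], [d] are 0, -1, 1. *)
have hx := hw x; have ha := hw a; have hd := hw d.
have e1 := rm_sym mx d; have aa := rm_dist0 mx a.
by split; move: hx ha hd;
  rewrite /halfsign !e1 ?xa ?xb ?xc ?xd ?ab ?bc ?cd ?ac ?bd ?ad ?aa; lia.
Qed.

(** Induction along a path in the neighbourhood: a path of length three either has a shortcut or
    satisfies the hypotheses of [nbr_path4]. *)
Lemma component_diam a b : adj x a -> connect e a b ->
  [\/ a = b, adj a b | exists z, [/\ adj x z, adj a z & adj z b]].
Proof.
move=> xa /connectP[p]; elim/last_ind: p b => [|p c IH] b.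
  by move=> _ /= ->; constructor 1.
rewrite rcons_path last_rcons => /andP[hp hc] ->.
have {IH} := IH _ hp erefl; set u := last a p in hc *.
case/and3P: hc => xu xc uc [au|au|[z [xz az zu]]].
- by constructor 2; rewrite au.
- by constructor 3; exists u.
have [->|nac] := eqVneq a c; first by constructor 1.
have [ac|nadj] := boolP (adj a c); first by constructor 2.
constructor 3.
have [au|nau] := boolP (adj a u); first by exists u.
have [zc|nzc] := boolP (adj z c); first by exists z.
have [Eau|Nau] := eqVneq a u; first by rewrite Eau uc in nadj.
have [Ezc|Nzc] := eqVneq z c; first by rewrite -Ezc az in nadj.
apply: (@nbr_path4 a z u c) => //.
- by rewrite (rm_nbr_dist mx) // (negPf Nau) (negPf nau).
- by rewrite (rm_nbr_dist mx) // (negPf Nzc) (negPf nzc).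
- by rewrite (rm_nbr_dist mx) // (negPf nac) (negPf nadj).
Qed.

Variable y : vtx G.
Hypothesis xy : adj x y.
Definition component : {set vtx G} := [set z | connect e y z].

Lemma component_nbr z : z \in component -> adj x z.
Proof.
rewrite inE => /(closed_connect nbr_closed); by rewrite !inE xy.
Qed.

Lemma component_step z w : z \in component -> adj x w -> adj z w -> w \in component.
Proof.
move=> zC xw zw; have xz := component_nbr zC; move: zC; rewrite !inE => h.
by apply: connect_trans h (connect1 _); rewrite /e /nbr_rel /= xz xw zw.
Qed.

(** The vertex [x] has half-sign 0 for every edge inside the component, so reflecting in such an
    edge keeps vertices adjacent to [x]. *)
Lemma component_rmetric :
  @rmetric (induced component) (fun a b => D (val a) (val b)).
Proof.
move=> a; have aC := valP a; have xa := component_nbr aC; split.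
- by move=> u v; rewrite (rm_eq0 mx) -(inj_eq val_inj).
- by move=> u v; rewrite (rm_sym mx).
- by move=> u v; rewrite /= (rm_adj mx).
- by move=> u v _ _; apply: (rm_nbr2 mx); apply: component_nbr (valP _).
- move=> u nua; have uC := valP u; have xu := component_nbr uC.
  have au : connect e (val a) (val u).
    by move: aC uC; rewrite !inE nbr_connectC => h; apply: connect_trans.
  have [E|adj_au|[z [xz az zu]]] := component_diam xa au.
  + by case/eqP: nua; apply/val_inj.
  + by exists u => //; rewrite !(rm_dist0 mx) lt0n (rm_eq0 mx).
  + have zC := component_step aC xz az.
    have [au1|nau1] := boolP (adj (val a) (val u)).
      by exists u => //; rewrite !(rm_dist0 mx) lt0n (rm_eq0 mx).
    exists (Sub z zC) => //=; rewrite (rm_nbr_dist mx xu xa) (inj_eq val_inj).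
    rewrite (negPf nua) (rm_adjC mx) (negPf nau1).
    by move: zu; rewrite (rm_adj mx) (rm_sym mx) => /eqP ->.
- move=> b v /= ab; have vC := valP v; have xv := component_nbr vC.
  have xb := component_nbr (valP b).
  have [w hw] := rm_refl (mG (val a)) (val v) ab.
  have ex : halfsign D (val a) (val b) x = 0%R.
    by rewrite /halfsign (rm_edge1 mx xa).1 (rm_edge1 mx xb).1.
  have xw : adj x w.
    rewrite (rm_adj mx); have := hw x.
    by rewrite ex mul0r addr0 (rm_edge1 mx xv).1; lia.
  (* The distance from [v] to [w] is the square of the half-sign of [v]. Being at most 2, it is 0 or
     1. *)
  have wC : w \in component.
    have := hw (val v); rewrite (rm_dist0 mx).
    have: D (val v) (val a) <= 2 by rewrite (rm_nbr2 mx).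
    have: D (val v) (val b) <= 2 by rewrite (rm_nbr2 mx).
    have: D (val v) w <= 2 by rewrite (rm_nbr2 mx).
    have vw0 : D (val v) w = 0 -> w \in component.
      by move/eqP; rewrite (rm_eq0 mx) => /eqP <-.
    have vw1 : D (val v) w = 1 -> w \in component.
      by move/eqP; rewrite -(rm_adj mx) => h; apply: component_step h.
    rewrite /halfsign; move=> h1 h2 h3 h4.
    have : D (val v) w = 0 \/ D (val v) w = 1.
      move: h1 h2 h3 h4; move: (D _ w) (D _ (val b)) (D _ (val a)) => p q r.
      case: p => [|[|[|p]]] // _; [by left|by right|].
      by case: q => [|[|[|q]]] // _; case: r => [|[|[|r]]].
    by case.
  by exists (Sub w wC) => u; apply: hw.
Qed.

End Component.

Section Glue.
Variables (G : sgraph) (A C : {set vtx G}).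
Hypotheses (CA : C \subset A).
Hypothesis noadj : forall a b, a \in C -> b \in A :\: C -> adj a b = false.
Hypothesis adjC : forall a b : vtx G, adj a b = adj b a.
Variables (H1 H2 : sgraph) (D1 : vtx H1 -> vtx H1 -> nat) (D2 : vtx H2 -> vtx H2 -> nat).
Variables (x1 : vtx H1) (x2 : vtx H2).
Hypotheses (m1 : rmodel D1 x1) (m2 : rmodel D2 x2).
Variables (al1 : vtx (induced C) -> vtx H1) (al2 : vtx (induced (A :\: C)) -> vtx H2).
Hypotheses (iso1 : nbr_iso x1 al1) (iso2 : nbr_iso x2 al2).

(** In a product the neighbourhood of a vertex is the disjoint union of the neighbourhoods in the
    factors, with no edges between them. *)
Lemma nbr_iso_glue : exists al : vtx (induced A) -> vtx (cart H1 H2),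
  @nbr_iso (induced A) (cart H1 H2) (x1, x2) al.
Proof.
(* The default [(x1, x2)] is never reached, as [C] and [A :\: C] cover [A]. *)
pose al (a : vtx (induced A)) : vtx (cart H1 H2) :=
  if insub (val a) is Some c then (al1 c, x2)
  else if insub (val a) is Some c then (x1, al2 c) else (x1, x2).
have al1E a (aC : val a \in C) : al a = (al1 (Sub (val a) aC), x2).
  by rewrite /al insubT.
have al2E a (aC : val a \in A :\: C) : al a = (x1, al2 (Sub (val a) aC)).
  by rewrite /al insubF ?insubT //; move: aC; rewrite inE => /andP[/negPf].
have cases (a : vtx (induced A)) : (val a \in C) \/ (val a \in A :\: C).
  by rewrite in_setD (valP a) andbT; case: (val a \in C); [left|right].
case: iso1 => inj1 nb1 ad1; case: iso2 => inj2 nb2 ad2.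
have N1 c : adj x1 (al1 c) by apply/nb1; exists c.
have N2 c : adj x2 (al2 c) by apply/nb2; exists c.
have neq1 c := rm_adj_neq m1 (N1 c).
have neq2 c := rm_adj_neq m2 (N2 c).
exists al; split.
- move=> a b; case: (cases a) => aC; case: (cases b) => bC;
    rewrite ?(al1E _ aC) ?(al1E _ bC) ?(al2E _ aC) ?(al2E _ bC) => -[].
  + by move/inj1 => [] /val_inj.
  + by move=> h; have := neq1 (Sub (val a) aC); rewrite h eqxx.
  + by move=> h; have := neq1 (Sub (val b) bC); rewrite h eqxx.
  + by move/inj2 => [] /val_inj.
- move=> [u v] /=; split.
    case/orP=> /andP[] => [/eqP <- /nb2[c ->]|/nb1[c ->] /eqP <-].
      have cA : val c \in A by have := valP c; rewrite inE => /andP[].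
      exists (Sub (val c) cA); have cC : val (Sub (val c) cA : vtx (induced A)) \in A :\: C.
        exact: (valP c).
      by rewrite (al2E _ cC); congr (_, al2 _); apply: val_inj.
    have cA : val c \in A by apply: (subsetP CA); apply: (valP c).
    exists (Sub (val c) cA); have cC : val (Sub (val c) cA : vtx (induced A)) \in C.
      exact: (valP c).
    by rewrite (al1E _ cC); congr (al1 _, _); apply: val_inj.
  case=> a; case: (cases a) => aC; rewrite ?(al1E _ aC) ?(al2E _ aC) => -[-> ->].
    by rewrite N1 eqxx orbT.
  by rewrite N2 eqxx.
- move=> a b; case: (cases a) => aC; case: (cases b) => bC;
    rewrite ?(al1E _ aC) ?(al1E _ bC) ?(al2E _ aC) ?(al2E _ bC) /=.
  + by rewrite eqxx andbT (rm_adjxx m2) andbF /= ad1.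
  + by rewrite noadj // (negPf (neq2 _)) (eq_sym _ x1) (negPf (neq1 _)) andbF.
  + by rewrite adjC noadj // (eq_sym _ x2) (negPf (neq2 _)) (negPf (neq1 _)) andbF.
  + by rewrite eqxx (rm_adjxx m1) orbF ad2.
Qed.

End Glue.

(** * Factors and their products *)

Definition johnson_dist n k (A B : vtx (Johnson n k)) : nat := #|val A :\: val B|.
Definition cocktail_dist k (u v : vtx (CP k)) : nat :=
  if u == v then 0 else if u.1 == v.1 then 2 else 1.
Definition halved_dist n (f g : vtx (halved_cube n)) : nat :=
  #|[set i | val f i != val g i]|./2.
(** Equal signs give distances 0, 1, 2 and opposite signs 1, 2, 3; only antipodes, with equal 2-sets
    and opposite signs, are at distance 3. *)
Definition gosset_dist (a b : vtx Gosset) : nat :=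
  if a.2 == b.2 then 2 - #|val a.1 :&: val b.1| else 1 + #|val a.1 :&: val b.1|.
Definition schlaefli_dist (a b : vtx Schlaefli) : nat := gosset_dist (val a) (val b).

(* The value for Hamming graphs is never used: they arise as products of the
   Johnson graphs J(n,1). *)
Definition factor_dist f : vtx (factor_graph f) -> vtx (factor_graph f) -> nat :=
  match f with
  | FCP k => @cocktail_dist k
  | FHamming n m => fun _ _ => 0
  | FJohnson n k => @johnson_dist n k
  | FHalvedCube n => @halved_dist n
  | FSchlaefli => schlaefli_dist
  | FGosset => gosset_dist
  end.

(* Excluded are the coincidences J(4,2) = CP(3) and those among small halved cubes. *)
Definition basic_factor f : bool :=
  match f with
  | FCP k => true
  | FHamming n m => false
  | FJohnson n k => (0 < k < n) && ~~ ((n == 4) && (k == 2))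
  | FHalvedCube n => 4 < n
  | FSchlaefli | FGosset => true
  end.

(** The last clause provides an edge, so that every factor adds at least one to the diameter of a
    product. *)
Definition good_factor f : Prop :=
  [/\ basic_factor f, exists x, rmodel (@factor_dist f) x
    & exists u v, @factor_dist f u v = 1].

Fixpoint prod_graph (fs : seq factor) : sgraph :=
  if fs is f :: fs' then cart (factor_graph f) (prod_graph fs') else Kgraph 1.

Fixpoint prod_dist (fs : seq factor) : vtx (prod_graph fs) -> vtx (prod_graph fs) -> nat :=
  match fs with
  | [::] => fun _ _ => 0
  | f :: fs' => cart_dist (@factor_dist f) (@prod_dist fs')
  end.

Fixpoint good_factors (fs : seq factor) : Prop :=
  if fs is f :: fs' then good_factor f /\ good_factors fs' else True.

Definition factor_nbr (C : sgraph) : Prop :=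
  exists f, [/\ basic_factor f &
    exists x, rmodel (@factor_dist f) x /\
      exists al : vtx C -> vtx (factor_graph f), nbr_iso x al].

Lemma rmodel_point (x : vtx (Kgraph 1)) : @rmodel (Kgraph 1) (fun _ _ => 0) x.
Proof.
split=> //=.
- by move=> u v; rewrite !ord1 eqxx.
- by move=> u v; rewrite !ord1 eqxx.
- by move=> u; rewrite !ord1 eqxx.
- by move=> u v; rewrite !ord1 eqxx.
Qed.

(** Components of the neighbourhood are split off one at a time, each giving a factor. The
    hypothesis on smaller graphs lets the lemma serve both the induction in diameter two and the
    theorem. *)
Lemma nbr_product (G : sgraph) D x :
  @rmetric G D ->
  (forall C : {set vtx G}, C != set0 -> #|C| < #|vtx G| ->
     @rmetric (@induced G C) (fun a b => D (val a) (val b)) ->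
     (forall a b, a \in C -> b \in C -> D a b <= 2) -> factor_nbr (induced C)) ->
  exists fs, good_factors fs /\ exists z, rmodel (@prod_dist fs) z /\
    exists al : vtx (induced [set y : vtx G | adj x y]) -> vtx (prod_graph fs),
      nbr_iso z al.
Proof.
move=> mG IHG; have mx := mG x.
(* Here [A] ranges over the unions of components. *)
suff main (A : {set vtx G}) : A \subset [set y | adj x y] -> closed (nbr_rel x) A ->
    exists fs, good_factors fs /\ exists z, rmodel (@prod_dist fs) z /\
      exists al : vtx (induced A) -> vtx (prod_graph fs), nbr_iso z al.
  by apply: main; [exact: subxx|exact: nbr_closed].
have [n] := ubnP #|A|; elim: n A => // n IH A.
rewrite ltnS => ltA sA clA.
have [A0|[y yA]] := set_0Vmem A.
  exists [::]; split=> //; exists ord0; split; first exact: rmodel_point.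
  have F (a : vtx (induced A)) : False by case: a => a; rewrite A0 inE.
  exists (fun a => match F a with end); split.
  - by move=> a; case: (F a).
  - by move=> z; rewrite !ord1; split=> // -[a]; case: (F a).
  - by move=> a; case: (F a).
have xy : adj x y by move/subsetP: sA => /(_ _ yA); rewrite inE.
pose C := component x y.
have yC : y \in C by rewrite inE connect0.
have CA : C \subset A.
  by apply/subsetP => z; rewrite inE => /(closed_connect clA) <-.
have clC : closed (nbr_rel x) C.
  move=> a b ab; rewrite !inE; apply/idP/idP => h; apply: connect_trans h (connect1 _) => //.
  by rewrite (nbr_rel_sym x mG).
have clAC : closed (nbr_rel x) (A :\: C).
  by move=> a b ab; rewrite !in_setD (clA _ _ ab) (clC _ _ ab).
have sAC : A :\: C \subset [set y | adj x y].
  by apply: subset_trans sA; apply: subsetDl.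
have ltAC : #|A :\: C| < n.
  apply: leq_trans ltA; apply/proper_card/properP; split; first exact: subsetDl.
  by exists y; rewrite // inE yC.
have [fs [gfs [z2 [m2 [al2 iso2]]]]] := IH _ ltAC sAC clAC.
have CN a : a \in C -> adj x a by apply: component_nbr.
have [f [bf [z1 [m1 [al1 iso1]]]]] : factor_nbr (induced C).
  apply: IHG.
  - by apply/set0Pn; exists y.
  - rewrite -cardsT; apply: proper_card; apply/properP; split; first exact: subsetT.
    by exists x => //; apply/negP => /CN; rewrite (rm_adjxx mx).
  - exact: component_rmetric.
  - by move=> a b /CN xa /CN xb; apply: (rm_nbr2 mx).
exists (f :: fs); split.
  split=> //; split=> //; first by exists z1.
  exists z1, (al1 (Sub y yC)).
  apply/eqP; rewrite -(rm_adj m1); case: iso1 => _ h _; apply/h; by eexists.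
exists (z1, z2); split; first exact: rmodel_cart.
apply: (nbr_iso_glue CA _ _ m1 m2 iso1 iso2).
- move=> a b aC bAC; apply/negP => ab.
  have xb : adj x b by move/subsetP: sAC => /(_ _ bAC); rewrite inE.
  by move: bAC; rewrite inE (component_step xy aC xb ab).
- exact: (rm_adjC mx).
Qed.

Lemma prod_graph_cart_list fs : exists f fs',
  prod_graph fs = cart_list (factor_graph f) (map factor_graph fs').
Proof.
(* [Hamming 1 0] computes to the one-point graph that ends [prod_graph]. *)
elim: fs => [|f fs [f' [fs' IH]]]; first by exists (FHamming 1 0), [::].
by exists f, (f' :: fs'); rewrite /= IH.
Qed.

(** * Johnson and cocktail party graphs *)

Section VectorModel.
Local Open Scope ring_scope.
Variables (T : Type) (I : finType) (D : T -> T -> nat) (p : T -> I -> int) (k : int).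
Hypothesis k0 : k != 0.
Hypothesis Dp : forall u v, \sum_i (p u i - p v i) ^+ 2 = k * (D u v)%:Z.

(* The last hypothesis says that p w is the orthogonal reflection of p v along
   p y - p x. *)
Lemma refl_at_vector x y v w : D y x = 1%N ->
  (forall i, p w i = p v i - halfsign D x y v * (p y i - p x i)) ->
  refl_at D x y v w.
Proof.
move=> yx hw u; set e := halfsign D x y v in hw *.
apply: (mulfI k0); rewrite -Dp.
under eq_bigr => i _ do rewrite hw.
(* The cross term, twice the inner product of [u - v] and [y - x], is written by polarization as a
   combination of squared distances. *)
have -> : \sum_i (p u i - (p v i - e * (p y i - p x i))) ^+ 2 =
   \sum_i (p u i - p v i) ^+ 2 +
   e * (\sum_i (p u i - p x i) ^+ 2 - \sum_i (p u i - p y i) ^+ 2 +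
        \sum_i (p v i - p y i) ^+ 2 - \sum_i (p v i - p x i) ^+ 2) +
   e ^+ 2 * \sum_i (p y i - p x i) ^+ 2.
  rewrite -sumrB -big_split /= -sumrB !mulr_sumr -!big_split /=.
  by apply: eq_bigr => i _; ring.
rewrite !Dp yx /halfsign -/e.
have -> : e = (D v x)%:Z - (D v y)%:Z by [].
ring.
Qed.

End VectorModel.

Lemma card_sumz (T : finType) (P : pred T) :
  (#|P|%:Z = \sum_i (P i : nat)%:Z)%R.
Proof.
rewrite -sum1_card big_mkcond /= (big_morph Posz PoszD (erefl _)).
by apply: eq_bigr => i _; rewrite unfold_in; case: (P i).
Qed.

Lemma card_setz (T : finType) (A : {set T}) :
  (#|A|%:Z = \sum_i (i \in A : nat)%:Z)%R.
Proof. exact: (card_sumz (mem A)). Qed.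

(** * Exchanging one element of a finite set *)

Section Exchange.
Variable T : finType.
Implicit Types X Y V : {set T}.

Lemma exchangeP X Y : #|X :\: Y| = 1 -> #|Y :\: X| = 1 ->
  exists a b, [/\ a \in X, b \notin X, a != b &
    forall i, (i \in Y) = (i == b) || (i != a) && (i \in X)].
Proof.
move=> /eqP/cards1P[a Ea] /eqP/cards1P[b Eb]; exists a, b.
have := set11 a; rewrite -Ea inE => /andP[aY aX].
have := set11 b; rewrite -Eb inE => /andP[bX bY].
have ab : a != b by apply: contraNneq bX => <-.
split=> // i; move/setP/(_ i): Ea; move/setP/(_ i): Eb; rewrite !inE.
have [->|ib] := eqVneq i b; first by rewrite bY.
have [->|ia] := eqVneq i a; first by rewrite (negPf aY).
by case: (i \in X); case: (i \in Y).
Qed.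

Lemma exchange_cardI X Y V a b : a \in X -> b \notin X ->
  (forall i, (i \in Y) = (i == b) || (i != a) && (i \in X)) ->
  #|V :&: Y| + (a \in V) = #|V :&: X| + (b \in V).
Proof.
move=> aX bX hY.
rewrite (cardsD1 b (V :&: Y)) (cardsD1 a (V :&: X)) !inE hY eqxx aX !andbT.
have -> : (V :&: Y) :\ b = (V :&: X) :\ a.
  apply/setP => i; rewrite !inE hY.
  have [->|ib] := eqVneq i b; first by rewrite (negPf bX) !andbF.
  by case: (i == a); rewrite ?andbF.
lia.
Qed.

(** The reflection along the difference of the two indicator vectors is the transposition of [a] and
    [b]. *)
Lemma exchange_reflection X Y V a b : a \in X -> b \notin X -> a != b ->
  (forall i, (i \in Y) = (i == b) || (i != a) && (i \in X)) ->
  exists2 W : {set T}, #|W| = #|V| & forall i,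
   ((i \in W : nat)%:Z = (i \in V : nat)%:Z -
     ((b \in V : nat)%:Z - (a \in V : nat)%:Z) *
     ((i \in Y : nat)%:Z - (i \in X : nat)%:Z))%R.
Proof.
move=> aX bX ab hY; exists (tperm a b @^-1: V).
  by rewrite card_preimset //; apply: perm_inj.
move=> i; rewrite inE hY; case: tpermP => [->|->|/eqP ia /eqP ib].
- by rewrite (negPf ab) eqxx aX /=; lia.
- by rewrite eqxx (negPf bX) /=; lia.
- by rewrite (negPf ia) (negPf ib) /=; lia.
Qed.

End Exchange.

Section Johnson.
Variables n k : nat.
Notation V := (vtx (Johnson n k)).
Notation D := (@johnson_dist n k).

Lemma johnson_card (A : V) : #|val A| = k. Proof. by apply/eqP; apply: (valP A). Qed.

Lemma johnson_cardI (A B : V) : #|val A :&: val B| + D A B = k.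
Proof. by rewrite cardsID johnson_card. Qed.

Lemma johnson_eq0 (A B : V) : (D A B == 0) = (A == B).
Proof.
rewrite cards_eq0 setD_eq0 -(inj_eq val_inj) eqEcard !johnson_card leqnn andbT //.
Qed.

Lemma johnson_sym (A B : V) : D A B = D B A.
Proof.
have := johnson_cardI A B; have := johnson_cardI B A; rewrite setIC; lia.
Qed.

Lemma johnson_sq (A B : V) :
  (\sum_i ((i \in val A : nat)%:Z - (i \in val B : nat)%:Z) ^+ 2 = 2 * (D A B)%:Z)%R.
Proof.
transitivity ((D A B)%:Z + (D B A)%:Z)%R; last by rewrite (johnson_sym B); lia.
rewrite /johnson_dist !card_setz -big_split /=; apply: eq_bigr => i _.
by rewrite !inE; case: (i \in val A); case: (i \in val B).
Qed.

Lemma johnson_rmodel (X : V) : rmodel D X.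
Proof.
have adjE (A B : V) : adj A B = (D A B == 1).
  rewrite /= (inj_eq val_inj) -johnson_eq0; have := johnson_cardI A B.
  by set c := #|_ :&: _|; lia.
have adj2 (A B : V) : adj A B -> #|val A :\: val B| = 1 /\ #|val B :\: val A| = 1.
  by rewrite -/(D A B) -/(D B A) (johnson_sym B) adjE => /eqP.
split=> //.
- exact: johnson_eq0.
- exact: johnson_sym.
- move=> Y Z; rewrite !adjE johnson_sym => /eqP h1 /eqP h2.
  apply: (@leq_trans (D Y X + D X Z)); last by rewrite h1 h2.
  apply: leq_trans (leq_card_setU _ _); apply: subset_leq_card.
  apply/subsetP => i; rewrite !inE.
  by case: (i \in val X); case: (i \in val Y); case: (i \in val Z).
- move=> U nUX.
  have : D U X != 0 by rewrite johnson_eq0.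
  have : D X U != 0 by rewrite johnson_eq0 eq_sym.
  rewrite !cards_eq0 => /set0Pn[a] /setDP[aX aU] /set0Pn[b] /setDP[bU bX].
  have ba : b != a by apply: contraNneq bX => ->.
  (* Trading a point of [X] outside [U] for a point of [U] outside [X] gives a neighbour nearer to
     [U]. *)
  have cY : #|b |: val X :\ a| == k.
    rewrite cardsU1 !inE (negPf bX) andbF; apply/eqP; apply: etrans (johnson_card X).
    by rewrite (cardsD1 a (val X)) aX.
  exists (Sub (b |: val X :\ a) cY).
    rewrite adjE; apply/eqP; apply/eqP/cards1P; exists a; apply/setP => i.
    rewrite !inE /=.
    have [->|ia] := eqVneq i a; first by rewrite eq_sym (negPf ba) aX.
    by case: (i \in val X); rewrite ?orbT ?andbF.
  apply: proper_card; apply/properP; split.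
    apply/subsetP => i; rewrite !inE /= !negb_or => /andP[/andP[ib]].
    rewrite negb_and negbK => /orP[/eqP -> aU'|-> //]; by rewrite aU' in aU.
  by exists b; rewrite !inE ?bX ?bU //= eqxx.
- move=> Y U XY; have [c1 c2] := adj2 _ _ XY.
  have [a [b [aX bX ab hY]]] := exchangeP c1 c2.
  have [W cW hW] := exchange_reflection (val U) aX bX ab hY.
  have cW' : #|W| == k by rewrite cW johnson_card.
  exists (Sub W cW').
  pose p (A : V) (i : 'I_n) : int := (i \in val A : nat)%:Z%R.
  apply: (@refl_at_vector _ _ _ p 2%R) => //.
  + exact: johnson_sq.
  + move=> i; rewrite /p hW; congr (_ - _ * _)%R.
    have := exchange_cardI (val U) aX bX hY.
    have := johnson_cardI U X; have := johnson_cardI U Y; rewrite /halfsign; lia.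
Qed.

Lemma johnson_dist_le (A B : V) : D A B <= k /\ D A B <= n - k.
Proof.
split; first by have := johnson_cardI A B; lia.
have := subset_leq_card (subsetDr (val A) (val B)).
have := cardsC (val B); rewrite johnson_card card_ord /johnson_dist.
set c := #|~: _|; set e := #|_ :\: _|; lia.
Qed.

End Johnson.

Section Cocktail.
Variable k : nat.
Notation V := (vtx (CP k)).
Notation D := (@cocktail_dist k).

Lemma cocktail_rmodel (x : V) : 1 < k -> rmodel D x.
Proof.
move=> k1; split.
- by move=> u v; rewrite /cocktail_dist; case: (u == v) => //; case: (u.1 == v.1).
- by move=> u v; rewrite /cocktail_dist (eq_sym u) (eq_sym u.1).
- move=> u v; rewrite /cocktail_dist /=.
  by have [->|_] := eqVneq u v; rewrite ?eqxx //; case: (u.1 == v.1).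
- by move=> y z _ _; rewrite /cocktail_dist; case: ifP => // _; case: ifP.
- move=> u ux; rewrite /cocktail_dist (negPf ux).
  have [E|N] := eqVneq u.1 x.1; last by exists u; rewrite ?eqxx //= eq_sym.
  (* The antipode of [x] is reached through any other pair; one exists as [1 < k]. *)
  have [j jx] : exists j, j != x.1.
    have : 0 < #|[set~ x.1]| by rewrite cardsC1 card_ord; lia.
    by rewrite card_gt0 => /set0Pn[j]; rewrite !inE; exists j.
  exists (j, true); first by rewrite /= eq_sym.
  have uj : (u == (j, true)) = false by apply: contraNF jx => /eqP uj; rewrite -E uj.
  by rewrite uj E eq_sym (negPf jx).
- case: x => i b [j c] [l e] /= ij.
  (* The pairs [i] and [j] are exchanged, with the twist that sends [(i, b)] to [(j, c)]. *)
  exists (if l == i then (j, e (+) b (+) c) else if l == j then (i, e (+) b (+) c) else (l, e)).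
  case=> m f; rewrite /halfsign /cocktail_dist.
  have ji : (j == i) = false by rewrite eq_sym (negPf ij).
  have [->|li] := eqVneq l i; [|have [->|lj] := eqVneq l j].
  + have [->|mi] := eqVneq m i; [|have [->|mj] := eqVneq m j];
      rewrite !xpair_eqE /= ?eqxx ?(negPf ij) ?ji ?(negPf mi) ?(negPf mj) /=;
      by case: b c e f => [] [] [] [].
  + have [->|mi] := eqVneq m i; [|have [->|mj] := eqVneq m j];
      rewrite !xpair_eqE /= ?eqxx ?(negPf ij) ?ji ?(negPf mi) ?(negPf mj) /=;
      by case: b c e f => [] [] [] [].
  + by rewrite !xpair_eqE /= (negPf li) (negPf lj) /= subrr mulr0 addr0.
Qed.

End Cocktail.

(** * Halved cubes and the Gosset graph *)

Section HalvedCube.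
Variable n : nat.
Notation V := (vtx (halved_cube n)).
Notation D := (@halved_dist n).

Definition supp (f : V) : {set 'I_n} := [set i | val f i].

Lemma supp_inj : injective supp.
Proof.
by move=> f g /setP E; apply/val_inj/ffunP => i; have := E i; rewrite !inE.
Qed.

Lemma supp_even (f : V) : ~~ odd #|supp f|.
Proof. exact: (valP f). Qed.

Lemma even_vertex (A : {set 'I_n}) : ~~ odd #|A| -> exists f : V, supp f = A.
Proof.
move=> hA; have h : ~~ odd #|[set i | [ffun i => i \in A] i]|.
  by rewrite (_ : [set i | _] = A) //; apply/setP => i; rewrite !inE ffunE.
by exists (Sub [ffun i => i \in A] h); apply/setP => i; rewrite !inE /= ffunE.
Qed.

Lemma hamming_supp (f g : V) :
  #|[set i | val f i != val g i]| + 2 * #|supp f :&: supp g| = #|supp f| + #|supp g|.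
Proof.
apply/eqP; rewrite -eqz_nat mul2n -addnn !PoszD !card_setz -!big_split /=.
by apply/eqP/eq_bigr => i _; rewrite !inE; case: (val f i); case: (val g i).
Qed.

(** Both supports are even, so the halving in [halved_dist] is exact. *)
Lemma halved_dist_supp (f g : V) :
  2 * D f g + 2 * #|supp f :&: supp g| = #|supp f| + #|supp g|.
Proof.
have := hamming_supp f g; rewrite /halved_dist.
have := supp_even f; have := supp_even g.
set a := #|[set i | _]|; lia.
Qed.

Lemma halved_eq0 (f g : V) : (D f g == 0) = (f == g).
Proof.
apply/eqP/eqP => [h|->]; last by have := halved_dist_supp g g; rewrite setIid; lia.
apply: supp_inj; have := halved_dist_supp f g; rewrite h.
have := subset_leq_card (subsetIl (supp f) (supp g)).
have := subset_leq_card (subsetIr (supp f) (supp g)).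
move=> h1 h2 h3; transitivity (supp f :&: supp g).
  by apply/esym/eqP; rewrite eqEcard subsetIl; lia.
by apply/eqP; rewrite eqEcard subsetIr; lia.
Qed.

Lemma halved_sym (f g : V) : D f g = D g f.
Proof.
have := halved_dist_supp f g; have := halved_dist_supp g f; rewrite setIC; lia.
Qed.

Lemma halved_adj (f g : V) : adj f g = (D f g == 1).
Proof.
have := hamming_supp f g; have := halved_dist_supp f g => /=.
set a := #|[set i | _]|; lia.
Qed.

Lemma halved_sq (f g : V) :
  (\sum_i ((i \in supp f : nat)%:Z - (i \in supp g : nat)%:Z) ^+ 2 = 2 * (D f g)%:Z)%R.
Proof.
have h1 := hamming_supp f g; have h2 := halved_dist_supp f g.
have -> : (2 * (D f g)%:Z = #|[set i | val f i != val g i]|%:Z)%R by move: h1 h2; lia.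
rewrite card_setz; apply: eq_bigr => i _.
by rewrite !inE; case: (val f i); case: (val g i).
Qed.

Lemma card_set2I (T : finType) (a b : T) (A : {set T}) : a != b ->
  #|A :&: [set a; b]| = (a \in A) + (b \in A).
Proof.
move=> ab; rewrite (cardsD1 a) (cardsD1 b) !inE eqxx (eq_sym b) ab eqxx orbT /= !andbT.
rewrite (_ : _ :\ _ = set0) ?cards0 ?addn0 //.
by apply/setP => i; rewrite !inE; case: (i == a); case: (i == b); rewrite ?andbF.
Qed.

Lemma halved_dist0 (o f : V) : supp o = set0 -> 2 * D f o = #|supp f|.
Proof. by move=> ho; have := halved_dist_supp f o; rewrite ho setI0 cards0; lia. Qed.

(** The neighbours of [o] have supports of size 2. The reflection of such an edge swaps and
    complements the coordinates at these two points. *)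
Lemma halved_rmodel (o : V) : supp o = set0 -> rmodel D o.
Proof.
move=> ho.
have adj0 y : adj o y -> #|supp y| = 2.
  by rewrite halved_adj halved_sym => /eqP h; rewrite -(halved_dist0 _ ho) h.
split.
- exact: halved_eq0.
- exact: halved_sym.
- exact: halved_adj.
- move=> y z /adj0 hy /adj0 hz.
  have := halved_dist_supp y z; rewrite hy hz; lia.
- move=> u uo.
  have : D u o != 0 by rewrite halved_eq0.
  have := halved_dist0 u ho => h0 h1.
  have : 1 < #|supp u| by lia.
  case/card_gt1P => a [b [au bu ab]].
  have [|y hy] := @even_vertex [set a; b]; first by rewrite cards2 ab.
  exists y.
    rewrite halved_adj halved_sym; have := halved_dist0 y ho.
    by rewrite hy cards2 ab; lia.
  have := halved_dist_supp u y; rewrite hy card_set2I // au bu cards2 ab; lia.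
- move=> y v oy; have /eqP/cards2P[a [b [ab hy]]] := adj0 _ oy.
  pose e : int := ((a \in supp v : nat)%:Z + (b \in supp v : nat)%:Z - 1)%R.
  have he : halfsign D o y v = e.
    have := halved_dist_supp v y; rewrite hy card_set2I // cards2 ab.
    have := halved_dist0 v ho; rewrite /halfsign /e; lia.
  pose W := [set i | if i == a then b \notin supp v else
                     if i == b then a \notin supp v else i \in supp v].
  have hW i : ((i \in W : nat)%:Z = (i \in supp v : nat)%:Z - e * (i \in [set a; b] : nat)%:Z)%R.
    rewrite !inE /e; have [->|ia] := eqVneq i a; first by rewrite !inE; case: (val v a); case: (val v b).
    have [->|ib] := eqVneq i b; first by rewrite !inE; case: (val v a); case: (val v b).
    by rewrite mulr0 subr0.
  have cW : (#|W|%:Z = #|supp v|%:Z - e * 2)%R.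
    have -> : (2 = #|[set a; b]|%:Z)%R by rewrite cards2 ab.
    rewrite !card_setz mulr_sumr -sumrB; apply: eq_bigr => i _; exact: hW.
  have [|w hw] := @even_vertex W; first by have := supp_even v; lia.
  pose p (f : V) (i : 'I_n) : int := (i \in supp f : nat)%:Z%R.
  exists w; apply: (@refl_at_vector _ _ _ p 2%R) => //.
  + exact: halved_sq.
  + by apply/eqP; rewrite halved_sym -halved_adj.
  + by move=> i; rewrite /p hw hW he hy ho in_set0 subr0.
Qed.

End HalvedCube.

Section Gosset.
Notation V := (vtx Gosset).
Notation D := gosset_dist.

Lemma gosset_card (a : V) : #|val a.1| = 2.
Proof. by apply/eqP; apply: (valP a.1). Qed.

Lemma gosset_vertex (A : {set 'I_8}) (s : bool) : #|A| = 2 ->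
  exists a : V, val a.1 = A /\ a.2 = s.
Proof. by move=> /eqP h; exists (Sub A h, s). Qed.

Lemma gosset_le2 (a b : V) : #|val a.1 :&: val b.1| <= 2.
Proof. by have := subset_leq_card (subsetIl (val a.1) (val b.1)); rewrite gosset_card. Qed.

Lemma gosset_eq2 (a b : V) : (#|val a.1 :&: val b.1| == 2) = (a.1 == b.1).
Proof.
rewrite -(inj_eq val_inj); apply/eqP/eqP => [h|->]; last by rewrite setIid gosset_card.
transitivity (val a.1 :&: val b.1).
  by apply/esym/eqP; rewrite eqEcard subsetIl h gosset_card.
by apply/eqP; rewrite eqEcard subsetIr h gosset_card.
Qed.

Lemma gosset_eq0 (a b : V) : (D a b == 0) = (a == b).
Proof.
have := gosset_eq2 a b; have := gosset_le2 a b.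
rewrite /gosset_dist -pair_eqE /pair_eq /=; case: (a.2 == b.2); rewrite ?andbT ?andbF //; lia.
Qed.

Lemma gosset_sym (a b : V) : D a b = D b a.
Proof. by rewrite /gosset_dist (eq_sym a.2) setIC. Qed.

Lemma gosset_adj (a b : V) : adj a b = (D a b == 1).
Proof.
have := gosset_le2 a b.
rewrite /= /gosset_rel /gosset_dist /= -setI_eq0 -cards_eq0; case: (a.2 == b.2) => /=; lia.
Qed.

Definition bool_sign (s : bool) : int := if s then 1%R else (-1)%R.
(** These are the vectors (3,3,-1,...,-1), up to permutation and sign. *)
Definition gosset_vec (a : V) (i : 'I_8) : int :=
  (bool_sign a.2 * (4 * (i \in val a.1 : nat)%:Z - 1))%R.

(** One formula replaces the case distinction on signs and the truncated subtraction. *)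
Lemma gosset_dist_int (a b : V) :
  (2 * (D a b)%:Z =
   3 + bool_sign a.2 * bool_sign b.2 * (1 - 2 * #|val a.1 :&: val b.1|%:Z))%R.
Proof.
have := gosset_le2 a b; rewrite /gosset_dist /bool_sign; case: a.2; case: b.2 => /=; lia.
Qed.

Lemma gosset_sq (a b : V) :
  (\sum_i (gosset_vec a i - gosset_vec b i) ^+ 2 = 32 * (D a b)%:Z)%R.
Proof.
have -> : (32 * (D a b)%:Z = 16 * (2 * (D a b)%:Z))%R by lia.
rewrite gosset_dist_int; set s : int := (bool_sign a.2 * bool_sign b.2)%R.
have -> : (\sum_i (gosset_vec a i - gosset_vec b i) ^+ 2 =
  \sum_i (8 * (i \in val a.1 : nat)%:Z + 8 * (i \in val b.1 : nat)%:Z + 2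
     - s * (32 * (i \in val a.1 :&: val b.1 : nat)%:Z
        - 8 * (i \in val a.1 : nat)%:Z - 8 * (i \in val b.1 : nat)%:Z + 2)))%R.
  apply: eq_bigr => i _; rewrite /gosset_vec /s /bool_sign in_setI.
  by case: (i \in _); case: (i \in _); case: a.2; case: b.2.
rewrite sumrB -mulr_sumr !big_split /= !sumrN -!mulr_sumr -!card_setz !gosset_card.
rewrite !sumr_const card_ord; set c := #|_ :&: _|; lia.
Qed.

Lemma halfsign_same_sign (h : int) (s t : bool) (cx cy a b : nat) :
  (2 * h = 3 + bool_sign s * bool_sign t * (1 - 2 * cx%:Z) -
           (3 + bool_sign s * bool_sign t * (1 - 2 * cy%:Z)))%R ->
  cy + a = cx + b -> (h = bool_sign s * bool_sign t * (b%:Z - a%:Z))%R.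
Proof. case: s; case: t; rewrite /bool_sign; lia. Qed.

Lemma halfsign_opposite_sign (h : int) (s t : bool) (cx cy : nat) :
  (2 * h = 3 + bool_sign s * bool_sign t * (1 - 2 * cx%:Z) -
           (3 + bool_sign s * - bool_sign t * (1 - 2 * cy%:Z)))%R ->
  (h = bool_sign s * bool_sign t * (1 - (cx + cy)%:Z))%R.
Proof. case: s; case: t; rewrite /bool_sign; lia. Qed.

(** For equal signs the reflection is the transposition of the two unshared points; for opposite
    signs it is governed by the 4-set formed by the two disjoint 2-sets. *)
Lemma gosset_refl (x y v : V) : adj x y -> exists w, refl_at D x y v w.
Proof.
move=> xy; have yx1 : D y x = 1 by apply/eqP; rewrite gosset_sym -gosset_adj.
suff [w hw] : exists w, forall i, (gosset_vec w i =
    gosset_vec v i - halfsign D x y v * (gosset_vec y i - gosset_vec x i))%R.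
  by exists w; apply: (@refl_at_vector _ _ _ gosset_vec 32%R) => //; apply: gosset_sq.
have dx := gosset_dist_int v x; have dy := gosset_dist_int v y.
have dxy : (2 * halfsign D x y v = 2 * (D v x)%:Z - 2 * (D v y)%:Z)%R.
  by rewrite /halfsign mulrBr.
rewrite dx dy in dxy.
move: xy yx1; rewrite /= /gosset_rel /= => /orP[]/andP[Es hI] _.
  move/eqP: Es => Es.
  have cxy : #|val x.1 :\: val y.1| = 1.
    by have := cardsID (val y.1) (val x.1); rewrite gosset_card (eqP hI) => -[].
  have cyx : #|val y.1 :\: val x.1| = 1.
    by have := cardsID (val x.1) (val y.1); rewrite gosset_card setIC (eqP hI) => -[].
  have [a [b [aX bX ab hY]]] := exchangeP cxy cyx.
  have [W cW hW] := exchange_reflection (val v.1) aX bX ab hY.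
  have [w [hw1 hw2]] : exists w : V, val w.1 = W /\ w.2 = v.2.
    by apply: gosset_vertex; rewrite cW gosset_card.
  have hc := exchange_cardI (val v.1) aX bX hY.
  have he : (halfsign D x y v = bool_sign v.2 * bool_sign x.2 *
      ((b \in val v.1 : nat)%:Z - (a \in val v.1 : nat)%:Z))%R.
    by apply: halfsign_same_sign hc; rewrite dxy Es.
  exists w => i; rewrite he /gosset_vec hw1 hw2 hW -Es /bool_sign.
  by case: v.2; case: x.2; ring.
have Ey : bool_sign y.2 = (- bool_sign x.2)%R by move: Es; case: x.2; case: y.2.
(* Up to sign, [y - x] is 2 off [Q] and -2 on it, and the half-sign of [v] is 1 minus the number of
   its points in [Q]. *)
pose Q := val x.1 :|: val y.1.
have XY0 : val x.1 :&: val y.1 = set0 by apply/eqP; rewrite setI_eq0.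
have hQ i : ((i \in Q : nat)%:Z = (i \in val x.1 : nat)%:Z + (i \in val y.1 : nat)%:Z)%R.
  move/setP/(_ i): XY0; rewrite !inE; by case: (i \in _); case: (i \in _).
have hVQ : #|val v.1 :&: Q| = #|val v.1 :&: val x.1| + #|val v.1 :&: val y.1|.
  by rewrite setIUr cardsU setIACA XY0 setI0 cards0 subn0.
have he : (halfsign D x y v = bool_sign v.2 * bool_sign x.2 * (1 - #|val v.1 :&: Q|%:Z))%R.
  by rewrite hVQ; apply: halfsign_opposite_sign; rewrite dxy Ey.
have hr i : (gosset_vec y i - gosset_vec x i = bool_sign x.2 * (2 - 4 * (i \in Q : nat)%:Z))%R.
  by rewrite /gosset_vec Ey hQ; ring.
have cQ : #|Q| = 4 by rewrite cardsU XY0 cards0 !gosset_card.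
have ss : (bool_sign x.2 * bool_sign x.2 = 1)%R by case: x.2.
have reduce w : (forall i, gosset_vec w i = gosset_vec v i -
     bool_sign v.2 * (1 - #|val v.1 :&: Q|%:Z) * (2 - 4 * (i \in Q : nat)%:Z))%R ->
   exists w, forall i, (gosset_vec w i = gosset_vec v i -
     halfsign D x y v * (gosset_vec y i - gosset_vec x i))%R.
  move=> hw; exists w => i; rewrite hw he hr; congr (_ - _)%R.
  by rewrite -[LHS]mul1r -ss; ring.
have : #|val v.1 :&: Q| <= 2.
  by have := subset_leq_card (subsetIl (val v.1) Q); rewrite gosset_card.
(* With one point in [Q], [v] is fixed. With none or two, the sign flips and the 2-set is replaced
   by its complement outside, respectively inside, [Q]. *)
case E : #|val v.1 :&: Q| => [|[|[|//]]] _.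
- have VQ0 : val v.1 :&: Q = set0 by apply/eqP; rewrite -cards_eq0 E.
  have [|w [hw1 hw2]] := @gosset_vertex (~: (val v.1 :|: Q)) (~~ v.2).
    have := cardsC (val v.1 :|: Q); rewrite cardsU VQ0 cards0 gosset_card cQ card_ord; lia.
  apply: (reduce w) => i; rewrite E /gosset_vec hw1 hw2 /bool_sign !inE.
  move/setP/(_ i): VQ0; rewrite !inE.
  by case: (i \in val v.1); case: (_ || _); case: v.2.
- by apply: (reduce v) => i; rewrite E; ring.
- have VQ : val v.1 \subset Q.
    by apply/setIidPl/eqP; rewrite eqEcard subsetIl E gosset_card.
  have [|w [hw1 hw2]] := @gosset_vertex (Q :\: val v.1) (~~ v.2).
    by have := cardsD Q (val v.1); rewrite setIC E cQ.
  apply: (reduce w) => i; rewrite E /gosset_vec hw1 hw2 /bool_sign in_setD.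
  move/subsetP/(_ i): VQ; case: (i \in val v.1); case: (i \in Q) => h;
    by [case: v.2|have := h isT].
Qed.

Lemma avoid_ord8 (s : seq 'I_8) : size s < 8 -> exists d, d \notin s.
Proof.
move=> h; have : ~~ ([set: 'I_8] \subset [set d in s]).
  apply: contraL h => /subset_leq_card; rewrite cardsT card_ord -leqNgt => h.
  by apply: leq_trans h _; rewrite cardsE card_size.
by case/subsetPn => d _; rewrite inE; exists d.
Qed.

(** A common neighbour of two antipodes would meet their 2-set in both one point and none. *)
Lemma gosset_nbr2 (x y z : V) : adj x y -> adj x z -> D y z <= 2.
Proof.
rewrite /= /gosset_rel /gosset_dist /= => xy xz.
have h1 := gosset_le2 y z; have h2 := gosset_eq2 y z.
have [_|E] := eqVneq y.2 z.2; first exact: leq_subr.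
have [yz|nyz] := eqVneq y.1 z.1; last by move: h1; rewrite leq_eqVlt h2 (negPf nyz).
rewrite yz in xy; move: E xy xz; rewrite -setI_eq0 -cards_eq0.
case: #|val x.1 :&: val z.1| => [|[|c]]; by case: y.2; case: z.2; case: x.2.
Qed.

Lemma gosset_pair (i j : 'I_8) (s : bool) : i != j ->
  exists y : V, [/\ val y.1 = [set i; j], y.2 = s &
    forall a : V, D a y = if a.2 == s then 2 - ((i \in val a.1) + (j \in val a.1))
                          else 1 + ((i \in val a.1) + (j \in val a.1))].
Proof.
move=> ij; have [|y [hy <-]] := @gosset_vertex [set i; j] s; first by rewrite cards2 ij.
by exists y; split=> // a; rewrite /gosset_dist hy card_set2I.
Qed.

Lemma gosset_desc (x u : V) : u != x -> exists2 y, adj x y & D u y < D u x.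
Proof.
move=> ux; have [ux1|nux1] := boolP (adj x u).
  have uu : D u u = 0 by apply/eqP; rewrite gosset_eq0.
  by exists u; rewrite // uu lt0n gosset_eq0.
have ux0 : D u x != 0 by rewrite gosset_eq0.
rewrite gosset_adj gosset_sym in nux1.
have /eqP/cards2P[a [b [ab hx]]] := gosset_card x.
have Dx : D u x = if u.2 == x.2 then 2 - ((a \in val u.1) + (b \in val u.1))
                  else 1 + ((a \in val u.1) + (b \in val u.1)).
  by rewrite /gosset_dist hx card_set2I.
have ax : a \in val x.1 by rewrite hx !inE eqxx.
have bx : b \in val x.1 by rewrite hx !inE eqxx orbT.
(* Replacing [b] or [a] by a point [d] in neither 2-set gives the candidates [y] and [z]. *)
have [|d] := @avoid_ord8 [:: a, b & enum (val u.1)].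
  by rewrite /= -cardE gosset_card.
rewrite !inE !negb_or mem_enum => /and3P[da db du].
have dx : d \in val x.1 = false by rewrite hx !inE (negPf da) (negPf db).
have ad : a != d by rewrite eq_sym.
have bd : b != d by rewrite eq_sym.
have [y [_ _ hy]] := gosset_pair x.2 ad.
have [z [_ _ hz]] := gosset_pair x.2 bd.
have xy : adj x y by rewrite gosset_adj hy eqxx ax dx.
have xz : adj x z by rewrite gosset_adj hz eqxx bx dx.
have uy := hy u; have uz := hz u; rewrite (negPf du) in uy uz.
have [Es|Es] := eqVneq u.2 x.2; last first.
  (* For opposite signs common points add distance, so the point dropped from [x] is one lying in
     [u]. *)
  rewrite (negPf Es) in Dx uy uz.
  case: (boolP (b \in val u.1)) Dx uy uz => hb Dx uy uz.
    by exists y; rewrite // Dx uy; case: (a \in val u.1).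
  exists z; rewrite // Dx uz; move: nux1; rewrite Dx; by case: (a \in val u.1).
rewrite Es eqxx in Dx.
(* For equal signs the 2-sets are now disjoint, and replacing [b] by a point of [u] gives a nearer
   neighbour. *)
have [au bu] : a \notin val u.1 /\ b \notin val u.1.
  by move: ux0 nux1; rewrite Dx; case: (a \in _); case: (b \in _).
have /eqP/cards2P[c [e [ce hu]]] := gosset_card u.
have cu : c \in val u.1 by rewrite hu !inE eqxx.
have ac : a != c by apply: contraNneq au => ->.
have [w [_ _ hw]] := gosset_pair x.2 ac.
have cx : c \in val x.1 = false.
  by rewrite hx !inE; apply/negP => /orP[] /eqP cE; move: au bu; rewrite -cE cu.
exists w; first by rewrite gosset_adj hw eqxx ax cx.
by rewrite Dx hw Es eqxx cu (negPf au) (negPf bu).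
Qed.

Lemma gosset_rmodel (x : V) : rmodel D x.
Proof.
split.
- exact: gosset_eq0.
- exact: gosset_sym.
- exact: gosset_adj.
- exact: gosset_nbr2.
- exact: gosset_desc.
- by move=> y v; apply: gosset_refl.
Qed.

End Gosset.

Section Schlaefli.
Notation V := (vtx Schlaefli).
Notation D := schlaefli_dist.

Lemma schlaefli_origin : exists g : vtx Gosset, [/\ val g.1 = base01, g.2 = true &
  forall a, adj g a = gosset_rel (base01, true) (val a.1, a.2)].
Proof.
have [|g [h1 h2]] := @gosset_vertex base01 true; first by rewrite cards2 -val_eqE /= !inordK.
by exists g; split=> // a; rewrite /= h1 h2.
Qed.

Lemma gosset_origin : exists g : vtx Gosset,
  exists al : vtx Schlaefli -> vtx Gosset, nbr_iso g al.
Proof.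
have [g [_ _ hg]] := schlaefli_origin; exists g, val; split=> //.
  exact: val_inj.
move=> y; rewrite hg; split=> [h|[c ->]]; last exact: (valP c).
by exists (Sub y h).
Qed.

End Schlaefli.

(** * Neighbourhoods in the factors *)

(** Preserving an explicit distance gives injectivity and adjacency at once. *)
Lemma factor_nbr_dist (C : sgraph) f (x : vtx (factor_graph f))
    (al : vtx C -> vtx (factor_graph f)) (d : vtx C -> vtx C -> nat) :
  basic_factor f -> rmodel (@factor_dist f) x ->
  (forall a b, d a b == 0 -> a = b) -> (forall a b, adj a b = (d a b == 1)) ->
  (forall a b, factor_dist (al a) (al b) = d a b) ->
  (forall a, factor_dist x (al a) = 1) ->
  (forall y, factor_dist x y = 1 -> exists a, y = al a) -> factor_nbr C.
Proof.
move=> bf m d0 d1 dal xal onto; exists f; split=> //; exists x; split=> //.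
exists al; split.
- by move=> a b E; apply: d0; rewrite -dal E (rm_dist0 m).
- move=> y; rewrite (rm_adj m); split=> [/eqP /onto //|[c ->]].
  by rewrite xal.
- by move=> a b; rewrite (rm_adj m) dal d1.
Qed.

(** * Subsets of a range split into two blocks *)

Section JoinSet.
Variables k m : nat.
Implicit Types (P : {set 'I_k}) (A : {set 'I_m}).

Definition join_set P A : {set 'I_(k + m)} :=
  [set l | match split l with inl i => i \in P | inr j => j \in A end].

Lemma join_setl P A i : (lshift m i \in join_set P A) = (i \in P).
Proof. by rewrite inE; have := unsplitK (inl i : 'I_k + 'I_m) => /= ->. Qed.

Lemma join_setr P A j : (rshift k j \in join_set P A) = (j \in A).
Proof. by rewrite inE; have := unsplitK (inr j : 'I_k + 'I_m) => /= ->. Qed.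

Lemma eq_join_set P A (B : {set 'I_(k + m)}) :
  (forall i, (lshift m i \in B) = (i \in P)) ->
  (forall j, (rshift k j \in B) = (j \in A)) -> B = join_set P A.
Proof.
move=> h1 h2; apply/setP => l; rewrite -(splitK l).
by case: (split l) => i /=; rewrite ?join_setl ?join_setr.
Qed.

Lemma join_set_split (B : {set 'I_(k + m)}) : exists P A, B = join_set P A.
Proof.
exists [set i | lshift m i \in B], [set j | rshift k j \in B].
by apply: eq_join_set => i; rewrite inE.
Qed.

Lemma card_join_set P A : #|join_set P A| = #|P| + #|A|.
Proof.
apply/eqP; rewrite -eqz_nat PoszD !card_setz big_split_ord /=.
by apply/eqP; congr (_ + _)%R; apply: eq_bigr => i _; rewrite ?join_setl ?join_setr.
Qed.

Lemma join_setI P P' A A' :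
  join_set P A :&: join_set P' A' = join_set (P :&: P') (A :&: A').
Proof. by apply: eq_join_set => i; rewrite !in_setI ?join_setl ?join_setr. Qed.

Lemma join_setD P P' A A' :
  join_set P A :\: join_set P' A' = join_set (P :\: P') (A :\: A').
Proof. by apply: eq_join_set => i; rewrite !in_setD ?join_setl ?join_setr. Qed.

End JoinSet.

(** A neighbour of the left block in J(n+m,n) drops one of its n points and gains one of the other
    m. The excluded case would use J(4,2). *)
Lemma factor_nbr_KK n m : 0 < n -> 0 < m -> ~~ ((n == 2) && (m == 2)) ->
  factor_nbr (cart (Kgraph n) (Kgraph m)).
Proof.
move=> n0 m0 nm.
have bf : basic_factor (FJohnson (n + m) n) by rewrite /=; lia.
have hx : #|join_set [set: 'I_n] (set0 : {set 'I_m})| == n.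
  by rewrite card_join_set cardsT card_ord cards0 addn0.
have hb (p : 'I_n * 'I_m) : #|join_set [set~ p.1] [set p.2]| == n.
  by rewrite card_join_set cardsC1 cards1 card_ord; lia.
pose d (p q : vtx (cart (Kgraph n) (Kgraph m))) : nat := (p.1 != q.1) + (p.2 != q.2).
pose mem_n (A : {set 'I_(n + m)}) := #|A| == n.
pose x : vtx (Johnson (n + m) n) := exist mem_n _ hx.
pose al (p : vtx (cart (Kgraph n) (Kgraph m))) : vtx (Johnson (n + m) n) :=
  exist mem_n _ (hb p).
apply: (@factor_nbr_dist (cart (Kgraph n) (Kgraph m)) (FJohnson (n + m) n) x al d) => //.
- exact: johnson_rmodel.
- by move=> [a b] [a' b']; rewrite /d /= addn_eq0 !eqb0 !negbK => /andP[/eqP -> /eqP ->].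
- move=> [a b] [a' b']; rewrite /d /=.
  by case: (a == a'); case: (b == b').
- move=> [a b] [a' b']; rewrite /d /= /johnson_dist /= join_setD card_join_set.
  congr (_ + _).
    have [->|aa] := eqVneq a a'; first by rewrite setDv cards0.
    rewrite (_ : _ :\: _ = [set a']) ?cards1 //; apply/setP => i; rewrite !inE negbK.
    by have [->|] := eqVneq i a'; rewrite ?andbF // eq_sym aa.
  have [->|bb] := eqVneq b b'; first by rewrite setDv cards0.
  rewrite (_ : _ :\: _ = [set b]) ?cards1 //; apply/setP => i; rewrite !inE.
  by have [->|] := eqVneq i b; rewrite ?andbF // bb.
- move=> [a b]; rewrite /= /johnson_dist /= join_setD card_join_set set0D cards0 addn0.
  by rewrite setTD setCK cards1.
- move=> y hy.
  have hy' : #|val y :\: join_set [set: 'I_n] set0| = 1.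
    by have := johnson_sym y x; rewrite /johnson_dist /= => ->.
  have [a [b [aX bX ab hY]]] := exchangeP hy hy'.
  have [i Ei] : exists i, a = lshift m i.
    by move: aX; rewrite -(splitK a); case: (split a) => i /=; [exists i|rewrite join_setr inE].
  have [j Ej] : exists j, b = rshift n j.
    by move: bX; rewrite -(splitK b); case: (split b) => j /=; [rewrite join_setl inE|exists j].
  exists (i, j); apply: val_inj; rewrite /=; apply: eq_join_set => l; rewrite hY Ei Ej.
    by rewrite join_setl !inE andbT eq_lrshift (inj_eq (@lshift_inj _ _)).
  by rewrite join_setr !inE andbF orbF (inj_eq (@rshift_inj _ _)).
Qed.

Lemma factor_nbr_CP k : 0 < k -> factor_nbr (CP k).
Proof.
move=> k0.
apply: (@factor_nbr_dist (CP k) (FCP k.+1) (ord0, false)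
  (fun p => (lift ord0 p.1, p.2)) (@cocktail_dist k)) => //.
- exact: cocktail_rmodel.
- by move=> a b; rewrite /cocktail_dist; have [//|_] := eqVneq a b; case: (a.1 == b.1).
- move=> a b; rewrite /cocktail_dist /=.
  by have [->|_] := eqVneq a b; rewrite ?eqxx //; case: (a.1 == b.1).
- move=> [i s]; rewrite /= /cocktail_dist /= xpair_eqE.
  by case: (unliftP ord0 i) => [j ->|->]; [exists (j, s)|rewrite eqxx; case: s].
Qed.

(** The 2-sets are the neighbours of the empty set in the halved cube. *)
Lemma factor_nbr_J2 n : 4 < n -> factor_nbr (Johnson n 2).
Proof.
move=> n5.
have [o ho] : exists o : vtx (halved_cube n), supp o = set0.
  by apply: even_vertex; rewrite cards0.
have hA (A : vtx (Johnson n 2)) : exists f : vtx (halved_cube n), supp f = val A.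
  by apply: even_vertex; rewrite johnson_card.
have [al hal] := fin_all_exists hA.
apply: (@factor_nbr_dist (Johnson n 2) (FHalvedCube n) o al (@johnson_dist n 2)) => //.
- exact: halved_rmodel.
- by move=> a b; rewrite johnson_eq0 => /eqP.
- by move=> a b; rewrite (rm_adj (johnson_rmodel a)).
- move=> a b; have := halved_dist_supp (al a) (al b); rewrite !hal !johnson_card.
  have := johnson_cardI a b; rewrite /=; set c := #|_ :&: _|; lia.
- by move=> a; rewrite /= halved_sym; have := halved_dist0 (al a) ho; rewrite hal johnson_card; lia.
- move=> y /= hy.
  have h : #|supp y| == 2 by rewrite -(halved_dist0 y ho) halved_sym hy.
  by exists (Sub (supp y) h); apply: supp_inj; rewrite hal.
Qed.

(** * The Schlaefli graph *)

Section SchlaefliModel.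
Notation V := (vtx Schlaefli).
Notation D := schlaefli_dist.

Definition bits3 (a b c : bool) : {set 'I_3} := [set i : 'I_3 | nth false [:: a; b; c] i].

Lemma card_bits3 a b c : #|bits3 a b c| = a + b + c.
Proof.
rewrite -sum1_card big_mkcond /= !big_ord_recl big_ord0 !inE /=.
by case: a; case: b; case: c.
Qed.

Lemma bits3I a b c a' b' c' :
  bits3 a b c :&: bits3 a' b' c' = bits3 (a && a') (b && b') (c && c').
Proof. by apply/setP => i; rewrite !inE; case: i => [[|[|[|i]]] hi]. Qed.

Lemma bits3_split (P : {set 'I_3}) : exists a b c, P = bits3 a b c.
Proof.
exists (inord 0 \in P), (inord 1 \in P), (inord 2 \in P); apply/setP => i; rewrite inE.
by case: i => [[|[|[|i]]] hi] //=; congr (_ \in P); apply: val_inj; rewrite /= inordK.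
Qed.

Lemma base01_join : base01 = join_set (bits3 true true false) (set0 : {set 'I_5}).
Proof.
apply: (@eq_join_set 3 5) => i; rewrite !inE -!val_eqE /= !inordK //.
by case: i => [[|[|[|i]]] hi].
Qed.

(* Coordinates over 'I_8 = 'I_(3 + 5): the points 0 and 1 give the Gosset vertex
   whose neighbourhood is taken, 0 and 2 the base point, and the other five index
   the halved 5-cube. *)
Definition schlaefli_at (y : V) (a b c : bool) (A : {set 'I_5}) (s : bool) : Prop :=
  val (val y).1 = join_set (bits3 a b c) A /\ (val y).2 = s.

(** The condition on [s] is adjacency to ({0,1}, true) in the Gosset graph. *)
Lemma schlaefli_vertex (a b c : bool) (A : {set 'I_5}) (s : bool) : a + b + c + #|A| = 2 ->
  (if s then a + b == 1 else ~~ a && ~~ b) -> exists y, schlaefli_at y a b c A s.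
Proof.
move=> h hs; have [|y [h1 h2]] := @gosset_vertex (join_set (bits3 a b c) A) s.
  by rewrite (@card_join_set 3 5) card_bits3.
have hy : gosset_rel (base01, true) (val y.1, y.2).
  rewrite /gosset_rel /= h1 h2 -setI_eq0 -cards_eq0 base01_join.
  rewrite (@join_setI 3 5) (@card_join_set 3 5) bits3I card_bits3 set0I cards0 /=.
  by move: hs; case: (s); case: (a); case: (b).
by exists (Sub y hy).
Qed.

Lemma schlaefli_coord (y : V) : exists a b c A s,
  [/\ schlaefli_at y a b c A s, a + b + c + #|A| = 2 &
      if s then a + b == 1 else ~~ a && ~~ b].
Proof.
rewrite /schlaefli_at.
have : gosset_rel (base01, true) (val (val y).1, (val y).2) := valP y.
move: (val y) => z; have [P [A hz]] := @join_set_split 3 5 (val z.1).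
have [a [b [c hP]]] := bits3_split P; rewrite hP in hz.
rewrite /gosset_rel /= hz -setI_eq0 -cards_eq0 base01_join.
rewrite (@join_setI 3 5) (@card_join_set 3 5) bits3I card_bits3 set0I cards0 /= => h.
exists a, b, c, A, z.2; split => //.
  by have := gosset_card z; rewrite hz (@card_join_set 3 5) card_bits3.
by move: h; case: z.2; case: (a); case: (b).
Qed.

Lemma schlaefli_at_dist y a b c A s y' a' b' c' A' s' :
  schlaefli_at y a b c A s -> schlaefli_at y' a' b' c' A' s' ->
  D y y' = let n := (a && a') + (b && b') + (c && c') + #|A :&: A'| in
    if s == s' then 2 - n else 1 + n.
Proof.
move=> [h1 h2] [h1' h2']; rewrite /schlaefli_dist /gosset_dist h1 h2 h1' h2'.
by rewrite (@join_setI 3 5) (@card_join_set 3 5) bits3I card_bits3.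
Qed.

Lemma schlaefli_eq0 (u v : V) : (D u v == 0) = (u == v).
Proof. by rewrite /schlaefli_dist gosset_eq0 (inj_eq val_inj). Qed.

Lemma schlaefli_adj (u v : V) : adj u v = (D u v == 1).
Proof. by rewrite -gosset_adj. Qed.

Lemma schlaefli_sym (u v : V) : D u v = D v u.
Proof. exact: gosset_sym. Qed.

(** Reflections come from the Gosset graph: the vertex whose neighbourhood is taken has half-sign 0
    for edges inside it, so the neighbourhood is preserved. *)
Lemma schlaefli_rmodel (x : V) : schlaefli_at x true false true set0 true -> rmodel D x.
Proof.
move=> hx; split.
- exact: schlaefli_eq0.
- exact: schlaefli_sym.
- exact: schlaefli_adj.
- by move=> y z; apply: gosset_nbr2.
- move=> u ux.
  have [ux1|nux1] := boolP (adj x u).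
    have uu : D u u = 0 by apply/eqP; rewrite schlaefli_eq0.
    by exists u; rewrite // uu lt0n schlaefli_eq0.
  have ux0 : D u x != 0 by rewrite schlaefli_eq0.
  rewrite schlaefli_adj schlaefli_sym in nux1.
  have [a [b [c [A [s [hu cu su]]]]]] := schlaefli_coord u.
  have Dx := schlaefli_at_dist hu hx; rewrite /= setI0 cards0 !andbT andbF in Dx.
  case: s hu su Dx => hu su Dx.
    (* For positive sign, [u] avoids 0 and 2, so it contains 1 and {1,2} is nearer. *)
    have [] := @schlaefli_vertex false true true set0 true; rewrite ?cards0 // => y hy.
    have ac : ~~ a && ~~ c by move: ux0 nux1; rewrite Dx; case: (a); case: (c).
    exists y; first by rewrite schlaefli_adj (schlaefli_at_dist hx hy) /= setI0 cards0.
    rewrite Dx (schlaefli_at_dist hu hy) /= setI0 cards0.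
    by move: su ac; case: (a); case: (b); case: (c).
  (* For negative sign, [u] contains 2 but not 0, so 0 together with a point outside [u] is
     nearer. *)
  have [k kA] : exists k, k \notin A.
    have := cardsC A; rewrite card_ord => hA.
    have : 0 < #|~: A| by move: cu hA; lia.
    by rewrite card_gt0 => /set0Pn[k]; rewrite inE; exists k.
  have [] := @schlaefli_vertex true false false [set k] true; rewrite ?cards1 // => y hy.
  exists y; first by rewrite schlaefli_adj (schlaefli_at_dist hx hy) /= set0I cards0.
  rewrite Dx (schlaefli_at_dist hu hy) /=.
  have -> : A :&: [set k] = set0.
    by apply/setP => i; rewrite !inE; have [->|] := eqVneq i k; rewrite ?andbF // (negPf kA).
  rewrite cards0; move: su nux1; rewrite Dx.
  by case: (a); case: (b); case: (c).
- move=> y v xy; have [w hw] := @gosset_refl (val x) (val y) (val v) xy.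
  have [g [_ _ hg]] := schlaefli_origin.
  have gw : gosset_rel (base01, true) (val w.1, w.2).
    rewrite -hg gosset_adj.
    have h (z : V) : gosset_dist g (val z) = 1.
      by apply/eqP; rewrite -gosset_adj hg; apply: (valP z).
    by have := hw g; rewrite /halfsign !h; lia.
  by exists (Sub w gw) => u; apply: hw.
Qed.

Lemma factor_nbr_halved5 : factor_nbr (halved_cube 5).
Proof.
have [] := @schlaefli_vertex true false true set0 true; rewrite ?cards0 // => x hx.
(* The 16 = 1 + 10 + 5 neighbours of [x], sorted by the size of the support. *)
pose cf (f : vtx (halved_cube 5)) (y : V) :=
  [\/ #|supp f| = 0 /\ schlaefli_at y false true true set0 true,
      #|supp f| = 2 /\ schlaefli_at y false false false (supp f) false |
      #|supp f| = 4 /\ schlaefli_at y true false false (~: supp f) true].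
have ex f : exists y, cf f y.
  have he := supp_even f; have hC := cardsC (supp f); rewrite card_ord in hC.
  have : [\/ #|supp f| = 0, #|supp f| = 2 | #|supp f| = 4].
    move: he; have := leq_addr #|~: supp f| #|supp f|; rewrite hC.
    by case: #|_| => [|[|[|[|[|[|]]]]]] // _ _; constructor.
  case=> h.
  - have [] := @schlaefli_vertex false true true set0 true; rewrite ?cards0 // => y hy.
    by exists y; constructor 1.
  - have [] := @schlaefli_vertex false false false (supp f) false => // y hy.
    by exists y; constructor 2.
  - have [] := @schlaefli_vertex true false false (~: supp f) true => //.
      by move: hC; rewrite h; lia.
    by move=> y hy; exists y; constructor 3.
have [al hal] := fin_all_exists ex.
apply: (@factor_nbr_dist (halved_cube 5) FSchlaefli x al (@halved_dist 5)) => //.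
- exact: schlaefli_rmodel.
- by move=> a b; rewrite halved_eq0 => /eqP.
- exact: halved_adj.
- move=> f g; rewrite /factor_dist.
  have hd := halved_dist_supp f g.
  have hfg := cardsID (supp g) (supp f).
  have hU := cardsC (supp f :|: supp g); rewrite card_ord cardsU in hU.
  have hgf : #|~: supp f :&: supp g| + #|supp f :&: supp g| = #|supp g|.
    by rewrite -(cardsID (supp f) (supp g)) addnC setIC setDE (setIC (~: _)).
  rewrite setDE in hfg; rewrite setCU in hU.
  have le1 := subset_leq_card (subsetIl (supp f) (supp g)).
  have le2 := subset_leq_card (subsetIr (supp f) (supp g)).
  case: (hal f) => -[cF yf]; case: (hal g) => -[cG yg];
    rewrite (schlaefli_at_dist yf yg) /= ?set0I ?setI0 ?cards0;
    move: hd hfg hU hgf le1 le2; rewrite cF cG; clear;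
    set c := #|supp f :&: supp g|; set c1 := #|supp f :&: ~: supp g|;
    set c2 := #|~: supp f :&: supp g|; set c3 := #|~: supp f :&: ~: supp g|;
    set h := halved_dist f g; lia.
- move=> f; rewrite /factor_dist.
  by case: (hal f) => -[_ yf]; rewrite (schlaefli_at_dist hx yf) /= set0I cards0.
- move=> y hy; rewrite /factor_dist in hy.
  have [a [b [c [A [s [yy cA sy]]]]]] := schlaefli_coord y.
  rewrite (schlaefli_at_dist hx yy) /= set0I cards0 in hy.
  suff [f hf] : exists f, D y (al f) == 0 by exists f; apply/eqP; rewrite -schlaefli_eq0.
  case: s sy yy hy => sy yy hy.
    case: a sy yy hy cA => sy yy hy cA.
      have [bF cF] : b = false /\ c = false by move: sy hy; case: (b); case: (c).
      have hC := cardsC A; rewrite card_ord in hC.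
      have c4 : #|~: A| = 4 by move: cA hC; rewrite bF cF; clear; lia.
      have [|f hf] := @even_vertex 5 (~: A); first by rewrite c4.
      case: (hal f) => -[]; rewrite hf c4 // => _ yf.
      exists f; rewrite (schlaefli_at_dist yy yf) setCK setIid.
      by move: cA; rewrite bF cF; case: #|A| => [|[|]].
    have [bT cT] : b = true /\ c = true by move: sy hy; case: (b); case: (c).
    have [|f hf] := @even_vertex 5 set0; first by rewrite cards0.
    case: (hal f) => -[]; rewrite hf cards0 // => _ yf.
    by exists f; rewrite (schlaefli_at_dist yy yf) bT cT.
  have [aF bF] : a = false /\ b = false by move: sy; case: (a); case: (b).
  have cF : c = false by move: hy; rewrite aF; case: (c).
  rewrite aF bF cF /= !add0n in cA.
  have [|f hf] := @even_vertex 5 A; first by rewrite cA.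
  case: (hal f) => -[]; rewrite hf cA // => _ yf.
  by exists f; rewrite (schlaefli_at_dist yy yf) setIid aF bF cF cA.
Qed.

End SchlaefliModel.

(** * Classification *)

Lemma factor_nbr_schlaefli : factor_nbr Schlaefli.
Proof.
have [g [al iso]] := gosset_origin.
by exists FGosset; split=> //; exists g; split; [exact: gosset_rmodel|exists al].
Qed.

(** Distances between neighbours of the base point are 0, 1 or 2 and hence determined by
    adjacency. *)
Lemma nbr_isometric (G H : sgraph) D D' (x : vtx G) (z : vtx H)
    (al : vtx (induced [set y : vtx G | adj x y]) -> vtx H) :
  rmodel D x -> rmodel D' z -> nbr_iso z al -> isometric D D'.
Proof.
move=> mG mH [inj nb ad].
have valN (a : vtx (induced [set y : vtx G | adj x y])) : adj x (val a).
  by have := valP a; rewrite inE.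
have alN a : adj z (al a) by apply/nb; exists a.
apply: (rmodel_isometric mG mH valN alN) => [y xy|y /nb //|i j].
  have yN : y \in [set y : vtx G | adj x y] by rewrite inE.
  by exists (Sub y yN).
by rewrite (rm_nbr_dist mG) // (rm_nbr_dist mH) // ad (inj_eq inj) (inj_eq val_inj).
Qed.

Lemma isometric_isomorphic (G H : sgraph) D D' (x : vtx G) (z : vtx H) :
  rmodel D x -> rmodel D' z -> isometric D D' -> isomorphic G H.
Proof.
move=> mG mH [f [bf hf]]; exists f; split=> // u v.
by rewrite (rm_adj mG) (rm_adj mH) hf.
Qed.

Lemma factor_nbr_isomorphic (C C' : sgraph) :
  isomorphic C C' -> factor_nbr C' -> factor_nbr C.
Proof.
move=> [g [bg hg]] [f [bf [x [m [al [inj nb ad]]]]]].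
exists f; split=> //; exists x; split=> //; exists (al \o g); split.
- exact: inj_comp (bij_inj bg).
- move=> y; split=> [/nb[c ->]|[c ->]]; last by apply/nb; exists (g c).
  by case: bg => h hK gK; exists (h c); rewrite /= gK.
- by move=> a b; rewrite /= ad hg.
Qed.

Lemma inj_surj_bij (A B : finType) (f : A -> B) :
  injective f -> (forall b, exists a, b = f a) -> bijective f.
Proof.
move=> inj /fin_all_exists[g hg]; exists g => [a|b]; last by rewrite -hg.
by apply: inj; rewrite -hg.
Qed.

Lemma subset_of_card (T : finType) (X : {set T}) k : k <= #|X| ->
  exists2 S : {set T}, S \subset X & #|S| = k.
Proof.
move=> le; exists [set x in take k (enum X)].
  by apply/subsetP => x; rewrite inE => /mem_take; rewrite mem_enum.
rewrite cardsE; have /card_uniqP -> : uniq (take k (enum X)) by rewrite take_uniq ?enum_uniq.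
by rewrite size_takel // -cardE.
Qed.

(** * Factors and products of diameter at most two *)

Lemma johnson_complement n k : k <= n ->
  isomorphic (Johnson n k) (Johnson n (n - k)).
Proof.
move=> kn.
have hc (A : {set 'I_n}) : #|~: A| = n - #|A|.
  by have := cardsC A; rewrite card_ord; lia.
have ex (A : vtx (Johnson n k)) : exists B : vtx (Johnson n (n - k)), val B = ~: val A.
  have h : #|~: val A| == n - k by rewrite hc johnson_card.
  by exists (Sub (~: val A) h).
have [f hf] := fin_all_exists ex.
exists f; split.
  apply: inj_surj_bij => [A B E|B].
    by apply/val_inj/setC_inj; rewrite -!hf E.
  have h : #|~: val B| == k by rewrite hc johnson_card; lia.
  by exists (Sub (~: val B) h); apply: val_inj; rewrite hf /= setCK.
move=> A B; rewrite (rm_adj (johnson_rmodel A)) (rm_adj (johnson_rmodel (f A))).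
by rewrite johnson_sym /johnson_dist !hf setDE setCK setIC -setDE.
Qed.

(** This and the next two lemmas rule out factors of diameter above two. *)
Lemma johnson_far n k : 2 < k -> 2 < n - k ->
  exists A B : vtx (Johnson n k), johnson_dist A B = 3.
Proof.
move=> k3 nk3.
have [A _ cA] := @subset_of_card _ [set: 'I_n] k ltac:(by rewrite cardsT card_ord; lia).
have [S SA cS] := @subset_of_card _ A 3 ltac:(by rewrite cA).
have [|T TA cT] := @subset_of_card _ (~: A) 3.
  by have := cardsC A; rewrite cA card_ord; lia.
have dAT : [disjoint A & T] by rewrite disjoint_sym disjoints_subset.
have TA0 : A :&: T = set0 by apply/eqP; rewrite setI_eq0.
have AB : A :\: (A :\: S :|: T) = S.
  by rewrite setDUr setDDr setDv set0U (setDidPl dAT) (setIidPr SA) (setIidPl SA).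
have hA : #|A| == k by rewrite cA.
have hB : #|A :\: S :|: T| == k.
  have -> : #|A :\: S :|: T| = #|A :\: S| + #|T|.
    by rewrite cardsU setIDAC TA0 set0D cards0 subn0.
  by have := cardsD A S; rewrite (setIidPr SA) cA cS cT; lia.
by exists (Sub A hA), (Sub (A :\: S :|: T) hB); rewrite /johnson_dist /= AB.
Qed.

Lemma halved_far n : 5 < n -> exists f g : vtx (halved_cube n), halved_dist f g = 3.
Proof.
move=> n6; have [S _ cS] := @subset_of_card _ [set: 'I_n] 6 ltac:(by rewrite cardsT card_ord).
have [|o ho] := @even_vertex n set0; first by rewrite cards0.
have [|f hf] := @even_vertex n S; first by rewrite cS.
by exists f, o; have := halved_dist0 f ho; rewrite hf cS; lia.
Qed.

Lemma gosset_far : exists a b, gosset_dist a b = 3.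
Proof.
have [S _ cS] := @subset_of_card _ [set: 'I_8] 2 ltac:(by rewrite cardsT card_ord).
have [a [ha sa]] := gosset_vertex true cS; have [b [hb sb]] := gosset_vertex false cS.
by exists a, b; rewrite /gosset_dist ha hb sa sb setIid cS.
Qed.

Lemma complete_isomorphic (G : sgraph) : (forall u v, @adj G u v = (u != v)) ->
  isomorphic G (Kgraph #|vtx G|).
Proof.
move=> h; exists enum_rank; split; first exact: enum_rank_bij.
by move=> u v; rewrite h /= (inj_eq enum_rank_inj).
Qed.

Lemma cart_isomorphic (G G' H H' : sgraph) :
  isomorphic G G' -> isomorphic H H' -> isomorphic (cart G H) (cart G' H').
Proof.
move=> [f [[f' fK f'K] hf]] [g [[g' gK g'K] hg]].
exists (fun p => (f p.1, g p.2)); split.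
  by exists (fun p => (f' p.1, g' p.2)) => -[a b] /=; rewrite ?fK ?gK ?f'K ?g'K.
by move=> [a b] [c d] /=; rewrite hf hg !(can_eq fK) (can_eq gK).
Qed.

Lemma cart_point_isomorphic (G : sgraph) : irreflexive (@adj G) ->
  isomorphic (cart G (Kgraph 1)) G.
Proof.
move=> irr; exists fst; split.
  by exists (fun a => (a, ord0)) => [[a b]|a] //=; rewrite (ord1 b).
by move=> [a b] [c d] /=; rewrite !ord1 eqxx andbF andbT.
Qed.

Lemma K1_cart_isomorphic (G : sgraph) : irreflexive (@adj G) ->
  isomorphic G (cart (Kgraph 1) G).
Proof.
move=> irr; exists (fun a => (ord0, a)); split.
  by exists snd => [a|[a b]] //=; rewrite (ord1 a).
by move=> u v /=; case: (adj u v).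
Qed.

Lemma K2K2_isomorphic : isomorphic (cart (Kgraph 2) (Kgraph 2)) (CP 2).
Proof.
(* The two diagonals of the 4-cycle become the antipodal pairs. *)
pose f (p : 'I_2 * 'I_2) : 'I_2 * bool :=
  (if p.1 == p.2 then ord0 else lift ord0 ord0, p.1 == ord0).
exists f; split.
  apply: inj_card_bij; last by rewrite !card_prod !card_ord card_bool.
  by move=> [[[|[|//]] i] [[|[|//]] j]] [[[|[|//]] i'] [[|[|//]] j']] //= _;
     congr (_, _); apply: val_inj.
by move=> [[[|[|//]] i] [[|[|//]] j]] [[[|[|//]] i'] [[|[|//]] j']].
Qed.

Lemma factor_nbr_two (G H : sgraph) :
  (forall u v, @adj G u v = (u != v)) -> (forall u v, @adj H u v = (u != v)) ->
  1 < #|vtx G| -> 1 < #|vtx H| -> factor_nbr (cart G H).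
Proof.
move=> cG cH nG nH.
have iso := cart_isomorphic (complete_isomorphic cG) (complete_isomorphic cH).
apply: factor_nbr_isomorphic iso _.
have [/andP[/eqP -> /eqP ->]|n22] := boolP ((#|vtx G| == 2) && (#|vtx H| == 2)).
  exact: factor_nbr_isomorphic K2K2_isomorphic (factor_nbr_CP _).
by apply: factor_nbr_KK => //; lia.
Qed.

(** A complete graph is treated as the product of one point and itself, a neighbourhood in
    J(n+1,1). *)
Lemma factor_nbr_complete (G : sgraph) : 0 < #|vtx G| ->
  (forall u v, @adj G u v = (u != v)) -> factor_nbr G.
Proof.
move=> nG cG; apply: factor_nbr_isomorphic (complete_isomorphic cG) _.
apply: factor_nbr_isomorphic (K1_cart_isomorphic _) _; first by move=> i; rewrite /= eqxx.
exact: factor_nbr_KK.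
Qed.

(** Diameter two leaves J(n,2) up to complement, with [n > 4] as J(4,2) is not basic, the halved
    5-cube, the Schlaefli graph and the cocktail party graphs. *)
Lemma factor_nbr_single f : basic_factor f ->
  (forall u v, @factor_dist f u v <= 2) ->
  (exists u v, @factor_dist f u v = 2) -> factor_nbr (factor_graph f).
Proof.
case: f => [k|n m|n k|n||] //= bf le [u [v uv]].
- by apply: factor_nbr_CP; case: u {uv} => [[i hi] _]; apply: leq_ltn_trans hi.
- have [k2 nk2] := johnson_dist_le u v; rewrite uv in k2 nk2.
  have near : k = 2 \/ n - k = 2.
    have [k3|] := ltnP 2 k; last by move=> h; left; apply/eqP; rewrite eqn_leq h.
    have [nk3|] := ltnP 2 (n - k); last by move=> h; right; apply/eqP; rewrite eqn_leq h.
    by have [A [B AB]] := johnson_far k3 nk3; have := le A B; rewrite AB.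
  case: near => h.
    by rewrite h in bf *; apply: factor_nbr_J2; lia.
  have kn : k <= n by lia.
  apply: factor_nbr_isomorphic (johnson_complement kn) _; rewrite h.
  by apply: factor_nbr_J2; lia.
- have [n6|n5] := ltnP 5 n.
    by have [f [g fg]] := halved_far n6; have := le f g; rewrite fg.
  have -> : n = 5 by apply/eqP; rewrite eqn_leq n5.
  exact: factor_nbr_halved5.
- exact: factor_nbr_schlaefli.
- by have [a [b ab]] := gosset_far; have := le a b; rewrite ab.
Qed.

Lemma dist_le1_complete (G : sgraph) D (x : vtx G) : rmodel D x ->
  (forall u v, D u v <= 1) -> forall u v : vtx G, adj u v = (u != v).
Proof.
move=> m le u v; rewrite (rm_adj m) -(rm_eq0 m).
by have := le u v; case: (D u v) => [|[|]].
Qed.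

(** Diameters add and each factor contributes at least one: there are at most two factors, and if
    two, both are complete. *)
Lemma factor_nbr_product fs z : good_factors fs -> rmodel (@prod_dist fs) z ->
  (forall u v, @prod_dist fs u v <= 2) ->
  (exists u v, @prod_dist fs u v = 2) -> factor_nbr (prod_graph fs).
Proof.
case: fs z => [|f [|g fs]] z /=; first by move=> _ _ _ [u [v]].
  move=> [[bf [x m] _] _] _ le [u [v uv]].
  apply: factor_nbr_isomorphic (cart_point_isomorphic (rm_adjxx m)) _.
  apply: factor_nbr_single => //.
    by move=> a b; have := le (a, ord0) (b, ord0); rewrite /cart_dist addn0.
  by exists u.1, v.1; move: uv; rewrite /cart_dist addn0.
move=> [[_ [x mf] [u [v uv]]] [[_ [y mg] [u' [v' uv']]] gfs]] m le _.
case: fs gfs z m le => [_ z m le|h fs [[_ _ [a [b ab]]] _] z _ le]; last first.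
  by have := le (u, (u', (a, z.2.2.2))) (v, (v', (b, z.2.2.2)));
  by rewrite /= /cart_dist /= uv uv' ab; lia.
have le1 a b : factor_dist (f:=f) a b <= 1.
  by have := le (a, (u', ord0)) (b, (v', ord0)); rewrite /cart_dist /= uv'; lia.
have le1' a b : factor_dist (f:=g) a b <= 1.
  by have := le (u, (a, ord0)) (v, (b, ord0)); rewrite /cart_dist /= uv; lia.
have cf := dist_le1_complete mf le1; have cg := dist_le1_complete mg le1'.
have big (H : sgraph) D (x0 : vtx H) p q :
    rmodel D x0 -> D p q = 1 -> 1 < #|vtx H|.
  move=> m0 pq; apply/card_gt1P; exists p, q; split=> //.
  by apply: (rm_adj_neq m0); rewrite (rm_adj m0) pq.
apply: factor_nbr_isomorphic (cart_isomorphic _ (cart_point_isomorphic (rm_adjxx mg))) _.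
  by exists id; split=> //; exists id.
by apply: factor_nbr_two => //; [apply: (big _ _ _ _ _ mf uv)|apply: (big _ _ _ _ _ mg uv')].
Qed.

(** Induction on the number of vertices: components of a neighbourhood are smaller, so [G] is
    isometric to a product of good factors, which inherits the diameter bound. *)
Lemma small_diam_factor_nbr (G : sgraph) D : 0 < #|vtx G| -> @rmetric G D ->
  (forall u v, D u v <= 2) -> factor_nbr G.
Proof.
have [n] := ubnP #|vtx G|; elim: n G D => // n IH G D.
rewrite ltnS => ltn /card_gt0P[x _] mG le.
have [fs [gfs [z [m [al iso]]]]] : exists fs, good_factors fs /\
    exists z, rmodel (@prod_dist fs) z /\
    exists al : vtx (induced [set y : vtx G | adj x y]) -> vtx (prod_graph fs),
      nbr_iso z al.
  apply: (nbr_product x mG) => C C0 ltC mC leC.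
  apply: (IH (induced C) (fun a b => D (val a) (val b))) => //.
  - by rewrite card_sig (leq_trans _ ltn) //; apply: leq_trans ltC; rewrite ltnS.
  - by case/set0Pn: C0 => c cC; apply/card_gt0P; exists (Sub c cC).
have iso2 := nbr_isometric (mG x) m iso.
have [le1|nle1] := boolP [forall u, forall v, D u v <= 1].
  apply: factor_nbr_complete; first by apply/card_gt0P; exists x.
  apply: (dist_le1_complete (mG x)) => u v.
  by move/forallP/(_ u)/forallP: le1.
apply: factor_nbr_isomorphic (isometric_isomorphic (mG x) m iso2) _.
case: iso2 => f [[f' fK f'K] hf].
apply: factor_nbr_product gfs m _ _.
  by move=> u v; rewrite -(f'K u) -(f'K v) hf.
case/forallPn: nle1 => u /forallPn[v]; rewrite -ltnNge => uv.
by exists (f u), (f v); rewrite hf; apply/eqP; rewrite eqn_leq le.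
Qed.

Theorem theorem2p16 (G : sgraph) :
  simple_graph G -> connected_graph G -> reflective G ->
  exists (f : factor) (fs : seq factor),
    isomorphic G (cart_list (factor_graph f) (map factor_graph fs)).
Proof.
move=> sG cG rG; have mG := reflective_rmetric sG cG rG.
have [/card_gt0P[x _]|] := ltnP 0 #|vtx G|; last first.
  rewrite leqn0 => /eqP/card0_eq G0.
  have F (u : vtx G) : False by have := G0 u; rewrite inE.
  (* The empty graph counts as connected here; it is [CP 0]. *)
  exists (FCP 0), [::], (fun u => match F u with end); split=> [|u]; last by case: (F u).
  have F' (u : vtx (CP 0)) : False by case: u => -[].
  by exists (fun u => match F' u with end) => u; [case: (F u)|case: (F' u)].
have [fs [_ [z [m [al iso]]]]] : exists fs, good_factors fs /\
    exists z, rmodel (@prod_dist fs) z /\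
    exists al : vtx (induced [set y : vtx G | adj x y]) -> vtx (prod_graph fs),
      nbr_iso z al.
  apply: (nbr_product x mG) => C C0 _ mC leC; apply: small_diam_factor_nbr mC _.
  - by case/set0Pn: C0 => c cC; apply/card_gt0P; exists (Sub c cC).
  - by move=> u v; apply: leC; apply: valP.
have [f [fs' E]] := prod_graph_cart_list fs.
exists f, fs'; rewrite -E.
exact: isometric_isomorphic (mG x) m (nbr_isometric (mG x) m iso).
Qed.
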